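(* There exist a closed target manifold $(N,g_N)$ and a solution $(u(t),g(t))$, $t\in[0,\infty)$, of Teichmüller harmonic map flow from $T^2$ into $(N,g_N)$ whose metric component leaves any compact subset of Teichmüller space (for every compact subset $K$ of Teichmüller space there is $T<\infty$ such that the class of $g(t)$ is not in $K$ for all $t\geq T$), even though the injectivity radius of the domain remains bounded away from zero, $\inf_{t\ge 0}\mathrm{inj}(T^2,g(t))>0$, and hence the metric component remains in a compact subset of moduli space.
   Context: Let $T^2=\mathbb{R}^2/\mathbb{Z}^2$ and let $\mathcal{M}_0$ be the space of smooth flat unit-area metrics on $T^2$. Teichmüller space is the quotient of $\mathcal{M}_0$ by pull-back by diffeomorphisms homotopic to the identity; moduli space is the quotient by pull-back by all orientation-preserving diffeomorphisms. Teichmüller space can be identified with $\mathcal{M}^*=\{g_{a,b}:(a,b)\in\mathbb{H}\}$, where $\mathbb{H}$ is the upper half plane and $g_{a,b}=T_{a,b}^*g_E$ with $g_E$ Euclidean and $T_{a,b}$ linear, $(1,0)\mapsto\frac1{\sqrt b}(1,0)$, $(0,1)\mapsto\frac1{\sqrt b}(a,b)$. Teichmüller harmonic map flow from $T^2$: fix a parameter $\eta>0$. For a map $u\colon T^2\to N$ and $g\in\mathcal{M}_0$ the Dirichlet energy is $E(u,g)=\frac12\int_{T^2}|du|_g^2\,dv_g$. The flow is its gradient flow $$\frac{\partial u}{\partial t}=\tau_g(u),\qquad \frac{\partial g}{\partial t}=\frac{\eta^2}{4}\mathrm{Re}\big(P_g(\Phi(u,g))\big),$$ where $\tau_g(u)=\mathrm{tr}_g\nabla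 du$ is the tension field, $\Phi(u,g)$ is the Hopf differential, i.e. $\Phi(u,g)=(|u_x|^2-|u_y|^2-2i\langle u_x,u_y\rangle)\,dz^2$ in local isothermal coordinates $z=x+iy$ of $(T^2,g)$, and $P_g$ is the $L^2(T^2,g)$-orthogonal projection from quadratic differentials onto the space of holomorphic quadratic differentials on $(T^2,g)$. Target manifolds are smooth closed Riemannian manifolds. *)

(* Defs.v *)
From HB Require Import structures.
From Stdlib Require Import Relation_Operators.
From mathcomp Require Import all_boot all_order all_algebra.
From mathcomp Require Import all_classical all_reals all_analysis.
From mathcomp Require Import complex.

Set Implicit Arguments.
Unset Strict Implicit.
Unset Printing Implicit Defensive.

Import Order.TTheory GRing.Theory Num.Theory numFieldNormedType.Exports.

Local Open Scope classical_set_scope.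
Local Open Scope ring_scope.
Local Open Scope quotient_scope.

(** * Differential calculus *)

(* C^k and C^oo regularity on an OPEN set U; for finite-dimensional V and
   open U this is the usual notion. *)
Fixpoint Ck (R : realType) (V W : normedModType R) (k : nat)
    (U : set V) (f : V -> W) {struct k} : Prop :=
  (forall x, U x -> {for x, continuous f}) /\
  match k with
  | 0 => True
  | k'.+1 => forall v : V,
      (forall x, U x -> derivable f x v) /\ Ck k' U (fun x => 'D_v f x)
  end.

Definition smooth (R : realType) (V W : normedModType R)
    (U : set V) (f : V -> W) : Prop := forall k, Ck k U f.

Definition pd (R : realType) (n : nat) (W : normedModType R) (i : 'I_n)
    (f : 'rV[R]_n -> W) (x : 'rV[R]_n) : W := 'D_(delta_mx 0 i) f x.

(* Row-vector convention: the entry (i, j) is the derivative of the j-th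
   component of f with respect to the i-th variable. *)
Definition Jac (R : realType) (n m : nat) (f : 'rV[R]_n -> 'rV[R]_m)
    (x : 'rV[R]_n) : 'M[R]_(n, m) := \matrix_(i, j) pd i f x 0 j.

(** * Riemannian metrics in coordinates *)

Definition spd (R : realType) (n : nat) (A : 'M[R]_n) : Prop :=
  A^T = A /\ forall v : 'rV[R]_n, v != 0 -> 0 < (v *m A *m v^T) 0 0.

(* Gamma^k_{ij} *)
Definition christoffel (R : realType) (n : nat) (G : 'rV[R]_n -> 'M[R]_n)
    (k i j : 'I_n) (x : 'rV[R]_n) : R :=
  2^-1 * \sum_l invmx (G x) k l *
    (pd i (fun y => G y j l) x + pd j (fun y => G y i l) x
     - pd l (fun y => G y i j) x).

(* R^l_{kij}, the l-th component of R(d_i, d_j) d_k *)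
Definition riemann (R : realType) (n : nat) (G : 'rV[R]_n -> 'M[R]_n)
    (l k i j : 'I_n) (x : 'rV[R]_n) : R :=
  pd i (fun y => christoffel G l j k y) x
  - pd j (fun y => christoffel G l i k y) x
  + \sum_m (christoffel G l i m x * christoffel G m j k x
            - christoffel G l j m x * christoffel G m i k x).

Definition is_geodesic (R : realType) (n : nat) (G : 'rV[R]_n -> 'M[R]_n)
    (gamma : R -> 'rV[R]_n) : Prop :=
  smooth [set: R] gamma /\
  forall (s : R) (k : 'I_n),
    derive1 (derive1 gamma) s 0 k
    + \sum_i \sum_j christoffel G k i j (gamma s)
        * derive1 gamma s 0 i * derive1 gamma s 0 j = 0.

(* Component a of tr_g(nabla dw), for w from a coordinate domain with metric g
   to a coordinate domain with metric G. *)
Definition tension (R : realType) (m d : nat) (g : 'rV[R]_m -> 'M[R]_m)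
    (G : 'rV[R]_d -> 'M[R]_d) (w : 'rV[R]_m -> 'rV[R]_d)
    (p : 'rV[R]_m) : 'rV[R]_d :=
  \row_a \sum_i \sum_j invmx (g p) i j *
    (pd i (fun q => pd j w q) p 0 a
     - \sum_k christoffel g k i j p * pd k w p 0 a
     + \sum_b \sum_c christoffel G a b c (w p)
         * pd i w p 0 b * pd j w p 0 c).

(** * Closed Riemannian manifolds *)

Record chart (R : realType) (d : nat) (M : topologicalType) := Chart {
  cdom : set M;
  cmap : M -> 'rV[R]_d;
  cinv : 'rV[R]_d -> M;
  cdom_open : open cdom;
  cimg_open : open (cmap @` cdom);
  cmap_cont : forall x, cdom x -> {for x, continuous cmap};
  cinv_cont : forall y, (cmap @` cdom) y -> {for y, continuous cinv};
  cmapK : forall x, cdom x -> cinv (cmap x) = x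
}.

Definition transition (R : realType) (d : nat) (M : topologicalType)
  (c c' : chart R d M) : 'rV[R]_d -> 'rV[R]_d := cmap c' \o cinv c.

Definition overlap (R : realType) (d : nat) (M : topologicalType)
  (c c' : chart R d M) : set 'rV[R]_d := cmap c @` (cdom c `&` cdom c').

(* Smooth, compact, without boundary; connectedness is not required. *)
Record closed_manifold (R : realType) (d : nat) := ClosedManifold {
  mcarrier :> topologicalType;
  mhausdorff : hausdorff_space mcarrier;
  msecond_countable : @second_countable mcarrier;
  mcompact : compact [set: mcarrier];
  atlas : set (chart R d mcarrier);
  atlas_cover : forall x : mcarrier, exists2 c, atlas c & cdom c x;
  atlas_smooth : forall c c', atlas c -> atlas c' ->
    smooth (overlap c c') (transition c c')
}.

(* A Riemannian metric, given by its coefficient matrices in the charts of the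
   atlas together with the transformation law of a (0,2)-tensor. *)
Record riem_metric (R : realType) (d : nat) (N : closed_manifold R d) :=
  RiemMetric {
  rm : chart R d N -> 'rV[R]_d -> 'M[R]_d;
  rm_smooth : forall c, atlas c -> smooth (cmap c @` cdom c) (rm c);
  rm_spd : forall c x, atlas c -> (cmap c @` cdom c) x -> spd (rm c x);
  rm_change : forall c c' x, atlas c -> atlas c' -> overlap c c' x ->
    rm c x = Jac (transition c c') x *m rm c' (transition c c' x)
               *m (Jac (transition c c') x)^T
}.

Definition smooth_map (R : realType) (V : normedModType R) (d : nat)
    (N : closed_manifold R d) (U : set V) (f : V -> N) : Prop :=
  (forall x, U x -> {for x, continuous f}) /\
  forall c, @atlas R d N c -> smooth (U `&` f @^-1` cdom c) (cmap c \o f).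

(** * The torus R^2/Z^2

   Functions, maps and tensor fields on the torus are Z^2-periodic functions
   on 'rV[R]_2; self-maps of the torus are given by lifts to 'rV[R]_2. *)

Definition lattice (R : realType) (k : 'rV[R]_2) : Prop :=
  forall i, k 0 i \is a Num.int.

Definition periodic (R : realType) (X : Type) (f : 'rV[R]_2 -> X) : Prop :=
  forall k p, lattice k -> f (p + k) = f p.

Definition pt (R : realType) (x y : R) : 'rV[R]_2 :=
  \row_i (if i == 0 then x else y).

Definition torus_int (R : realType) (f : 'rV[R]_2 -> R) : R :=
  (\int[lebesgue_measure]_(x in `[0, 1])
     (\int[lebesgue_measure]_(y in `[0, 1]) f (pt x y)))%R.

Record flat_metric (R : realType) := FlatMetric {
  fmx :> 'rV[R]_2 -> 'M[R]_2;
  fmx_periodic : periodic fmx;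
  fmx_smooth : smooth [set: 'rV[R]_2] fmx;
  fmx_spd : forall p, spd (fmx p);
  fmx_flat : forall l k i j p, riemann fmx l k i j p = 0;
  fmx_area : torus_int (fun p => Num.sqrt (\det (fmx p))) = 1
}.

HB.instance Definition _ (R : realType) := gen_eqMixin (flat_metric R).
HB.instance Definition _ (R : realType) := gen_choiceMixin (flat_metric R).

(** The C^oo topology on the space of flat unit-area metrics *)

Definition ipd (R : realType) (W : normedModType R) (s : seq 'I_2)
    (f : 'rV[R]_2 -> W) : 'rV[R]_2 -> W := foldr (fun i h => pd i h) f s.

Definition Cinf_close (R : realType) (k : nat) (e : R) (g h : flat_metric R) :=
  forall s p, (size s <= k)%N -> `|ipd s h p - ipd s g p| <= e.

Definition Cinf_open (R : realType) (A : set (flat_metric R)) : Prop :=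
  forall g, A g -> exists k, exists2 e : R, 0 < e & Cinf_close k e g `<=` A.

Section flat_metric_topology.
Variable R : realType.

Let opT : Cinf_open [set: flat_metric R].
Proof. by move=> g _; exists 0%N, 1. Qed.

Let opI (A B : set (flat_metric R)) :
  Cinf_open A -> Cinf_open B -> Cinf_open (A `&` B).
Proof.
move=> oA oB g [/oA[k [e e0 kA]] /oB[l [f f0 lB]]].
exists (maxn k l), (Num.min e f); first by rewrite lt_min e0 f0.
move=> h gh; split; [apply: kA | apply: lB] => s p sk.
- by apply: le_trans (gh s p (leq_trans sk (leq_maxl _ _))) _; rewrite ge_min lexx.
- by apply: le_trans (gh s p (leq_trans sk (leq_maxr _ _))) _;
    rewrite ge_min lexx orbT.
Qed.

Let op_bigU (I : Type) (F : I -> set (flat_metric R)) :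
  (forall i, Cinf_open (F i)) -> Cinf_open (\bigcup_i F i).
Proof.
move=> oF g [i _ /oF[k [e e0 kF]]]; exists k, e => // h gh.
by exists i => //; exact: kF.
Qed.

HB.instance Definition _ :=
  isOpenTopological.Build (flat_metric R) opT opI op_bigU.

End flat_metric_topology.

(** Diffeomorphisms of the torus *)

Definition torus_map (R : realType) (F : 'rV[R]_2 -> 'rV[R]_2) : Prop :=
  forall k p, lattice k -> lattice (F (p + k) - F p).

Definition torus_diffeo (R : realType) (F : 'rV[R]_2 -> 'rV[R]_2) : Prop :=
  exists F' : 'rV[R]_2 -> 'rV[R]_2,
    [/\ torus_map F /\ torus_map F', smooth [set: 'rV[R]_2] F,
        smooth [set: 'rV[R]_2] F', cancel F F' & cancel F' F].

(* Every homotopy [0, 1] x T^2 -> T^2 lifts to [0, 1] x R^2; two lifts define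
   the same map of the torus when they differ by lattice vectors. *)
Definition homotopic_to_id (R : realType) (F : 'rV[R]_2 -> 'rV[R]_2) : Prop :=
  exists H : R * 'rV[R]_2 -> 'rV[R]_2,
    [/\ {within [set z | 0 <= z.1 <= 1], continuous H},
        forall s, 0 <= s <= 1 -> torus_map (fun p => H (s, p)),
        forall p, lattice (H (0, p) - p) &
        forall p, lattice (H (1, p) - F p)].

Definition orientation_preserving (R : realType)
    (F : 'rV[R]_2 -> 'rV[R]_2) : Prop := forall p, 0 < \det (Jac F p).

Definition pullback (R : realType) (F : 'rV[R]_2 -> 'rV[R]_2)
    (g : 'rV[R]_2 -> 'M[R]_2) (p : 'rV[R]_2) : 'M[R]_2 :=
  Jac F p *m g (F p) *m (Jac F p)^T.

(** Teichmueller space and moduli space *)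

Definition teich_rel (R : realType) (g h : flat_metric R) : Prop :=
  exists F, [/\ torus_diffeo F, homotopic_to_id F &
                forall p, h p = pullback F g p].

Definition moduli_rel (R : realType) (g h : flat_metric R) : Prop :=
  exists F, [/\ torus_diffeo F, orientation_preserving F &
                forall p, h p = pullback F g p].

(* The two relations above are orbit relations of group actions, hence already
   equivalences; passing to the generated equivalence does not change them and
   only spares the verification. *)
Definition generated (T : Type) (r : T -> T -> Prop) (x y : T) : bool :=
  `[< clos_refl_sym_trans T r x y >].

Lemma generated_refl (T : Type) (r : T -> T -> Prop) :
  reflexive (generated r).
Proof. by move=> x; exact/asboolP/rst_refl. Qed.

Lemma generated_sym (T : Type) (r : T -> T -> Prop) :
  symmetric (generated r).
Proof. by move=> x y; apply/asboolP/asboolP => ?; exact: rst_sym. Qed.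

Lemma generated_trans (T : Type) (r : T -> T -> Prop) :
  transitive (generated r).
Proof.
by move=> y x z /asboolP xy /asboolP yz; apply/asboolP; exact: rst_trans xy yz.
Qed.

Definition generated_equiv_rel (T : Type) (r : T -> T -> Prop) : equiv_rel T :=
  EquivRel (generated r) (@generated_refl T r) (@generated_sym T r)
    (@generated_trans T r).

Definition teichmuller (R : realType) : topologicalType :=
  quotient_topology {eq_quot (generated_equiv_rel (@teich_rel R))}.

Definition moduli (R : realType) : topologicalType :=
  quotient_topology {eq_quot (generated_equiv_rel (@moduli_rel R))}.

Definition teich_class (R : realType) (g : flat_metric R) : teichmuller R :=
  \pi_({eq_quot (generated_equiv_rel (@teich_rel R))}) g.

Definition moduli_class (R : realType) (g : flat_metric R) : moduli R :=
  \pi_({eq_quot (generated_equiv_rel (@moduli_rel R))}) g.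

(** Injectivity radius *)

Definition diffeo_onto_image (R : realType) (U : set 'rV[R]_2)
    (f : 'rV[R]_2 -> 'rV[R]_2) : Prop :=
  [/\ smooth U f, open (f @` U) &
      exists f', smooth (f @` U) f' /\ forall v, U v -> f' (f v) = v].

(* e is (a lift of) the exponential map at p. *)
Definition is_exp (R : realType) (g : 'rV[R]_2 -> 'M[R]_2) (p : 'rV[R]_2)
    (e : 'rV[R]_2 -> 'rV[R]_2) : Prop :=
  forall v, [/\ is_geodesic g (fun s => e (s *: v)), e 0 = p &
                derive1 (fun s => e (s *: v)) 0 = v].

Definition tangent_ball (R : realType) (g : 'rV[R]_2 -> 'M[R]_2)
    (p : 'rV[R]_2) (r : R) : set 'rV[R]_2 :=
  [set v | (v *m g p *m v^T) 0 0 < r ^+ 2].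

(* The last condition says that the covering projection R^2 -> T^2 is injective
   on the image of the ball. *)
Definition exp_diffeo (R : realType) (g : 'rV[R]_2 -> 'M[R]_2)
    (p : 'rV[R]_2) (r : R) : Prop :=
  exists e, [/\ is_exp g p e, diffeo_onto_image (tangent_ball g p r) e &
    forall v w, tangent_ball g p r v -> tangent_ball g p r w ->
      lattice (e v - e w) -> v = w].

Definition inj_at (R : realType) (g : 'rV[R]_2 -> 'M[R]_2)
    (p : 'rV[R]_2) : \bar R :=
  ereal_sup [set r%:E | r in [set r : R | 0 < r /\ exp_diffeo g p r]].

Definition inj_radius (R : realType) (g : 'rV[R]_2 -> 'M[R]_2) : \bar R :=
  ereal_inf [set inj_at g p | p in [set: 'rV[R]_2]].

(** * Quadratic differentials on (T^2, g)

   A quadratic differential is represented by the matrix field of the complex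
   bilinear form phi dz (x) dz in the standard coordinates of R^2. *)

Definition cfield (R : realType) : numFieldType := R[i]%C.

Definition qfield (R : realType) := 'rV[R]_2 -> 'M[cfield R]_2.

(* z : W -> R^2 = C are isothermal coordinates compatible with the standard
   orientation of T^2. *)
Definition isothermal (R : realType) (g : 'rV[R]_2 -> 'M[R]_2)
    (W : set 'rV[R]_2) (z : 'rV[R]_2 -> 'rV[R]_2) : Prop :=
  [/\ open W, smooth W z, set_inj W z,
      forall p, W p -> 0 < \det (Jac z p) &
      forall p, W p -> exists2 rho : R, 0 < rho &
        g p = rho *: (Jac z p *m (Jac z p)^T)].

Definition zcoord (R : realType) (z : 'rV[R]_2 -> 'rV[R]_2) (p : 'rV[R]_2) :
    cfield R := (z p 0 0 +i* z p 0 1)%C.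

Definition dz (R : realType) (z : 'rV[R]_2 -> 'rV[R]_2) (p : 'rV[R]_2) :
    'rV[cfield R]_2 := \row_i (Jac z p i 0 +i* Jac z p i 1)%C.

Definition dz2 (R : realType) (z : 'rV[R]_2 -> 'rV[R]_2) (p : 'rV[R]_2) :
    'M[cfield R]_2 := (dz z p)^T *m dz z p.

(* The derivatives of w with respect to the coordinates z = (x, y): row 0 is
   w_x and row 1 is w_y, by the chain rule. *)
Definition coord_deriv (R : realType) (d : nat) (z : 'rV[R]_2 -> 'rV[R]_2)
    (w : 'rV[R]_2 -> 'rV[R]_d) (p : 'rV[R]_2) : 'M[R]_(2, d) :=
  invmx (Jac z p) *m Jac w p.

(* |w_x|^2 - |w_y|^2 - 2 i <w_x, w_y> for the target metric G *)
Definition hopf_coef (R : realType) (d : nat) (G : 'rV[R]_d -> 'M[R]_d)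
    (z : 'rV[R]_2 -> 'rV[R]_2) (w : 'rV[R]_2 -> 'rV[R]_d) (p : 'rV[R]_2) :
    cfield R :=
  let A := coord_deriv z w p *m G (w p) *m (coord_deriv z w p)^T in
  ((A 0 0 - A 1 1) -i* (2 * A 0 1))%C.

(* Phi is the Hopf differential of u.  The expression does not depend on the
   choice of isothermal coordinates around a point. *)
Definition is_hopf (R : realType) (d : nat) (N : closed_manifold R d)
    (gN : riem_metric N) (u : 'rV[R]_2 -> N) (g : 'rV[R]_2 -> 'M[R]_2)
    (Phi : qfield R) : Prop :=
  forall p0, exists W z, [/\ isothermal g W z, W p0 &
    forall p c, W p -> @atlas R d N c -> cdom c (u p) ->
      Phi p = hopf_coef (rm gN c) z (cmap c \o u) p *: dz2 z p].

Definition holomorphic_qd (R : realType) (g : 'rV[R]_2 -> 'M[R]_2)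
    (Psi : qfield R) : Prop :=
  periodic Psi /\
  forall p0, exists W z (phi : cfield R -> cfield R),
    [/\ isothermal g W z, W p0 &
      forall p, W p -> derivable phi (zcoord z p) 1 /\
                       Psi p = phi (zcoord z p) *: dz2 z p].

(* The pointwise Hermitian product times the volume density of g *)
Definition qd_density (R : realType) (g : 'rV[R]_2 -> 'M[R]_2)
    (Phi Psi : qfield R) (p : 'rV[R]_2) : R[i]%C :=
  ((Num.sqrt (\det (g p)))%:C)%C *
  \sum_i \sum_j \sum_k \sum_l
    ((invmx (g p) i k * invmx (g p) j l)%:C)%C
      * Phi p i j * conjc (Psi p k l).

Definition qd_inner (R : realType) (g : 'rV[R]_2 -> 'M[R]_2)
    (Phi Psi : qfield R) : R[i]%C :=
  (torus_int (fun p => complex.Re (qd_density g Phi Psi p))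
   +i* torus_int (fun p => complex.Im (qd_density g Phi Psi p)))%C.

(* Psi = P_g(Phi) *)
Definition is_hol_projection (R : realType) (g : 'rV[R]_2 -> 'M[R]_2)
    (Phi Psi : qfield R) : Prop :=
  holomorphic_qd g Psi /\
  forall Theta, holomorphic_qd g Theta ->
    qd_inner g (fun p => Phi p - Psi p) Theta = 0.

(** * Teichmueller harmonic map flow on [0, oo)

   Only the times t >= 0 matter; smoothness up to t = 0 means that the solution
   extends smoothly to slightly negative times. *)
Record thm_flow (R : realType) (eta : R) (d : nat) (N : closed_manifold R d)
    (gN : riem_metric N) (u : R -> 'rV[R]_2 -> N) (g : R -> flat_metric R) :
    Prop := ThmFlow {
  flow_periodic : forall t, periodic (u t);
  flow_smooth : exists2 e : R, 0 < e &
    smooth_map [set tp : R * 'rV[R]_2 | - e < tp.1] (fun tp => u tp.1 tp.2) /\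
    smooth [set tp : R * 'rV[R]_2 | - e < tp.1] (fun tp => g tp.1 tp.2);
  flow_map : forall t p c, 0 <= t -> @atlas R d N c -> cdom c (u t p) ->
    derive1 (fun s => cmap c (u s p)) t =
    tension (g t) (rm gN c) (cmap c \o u t) p;
  flow_metric : forall t, 0 <= t -> exists Phi Psi : qfield R,
    [/\ is_hopf gN (u t) (g t) Phi, is_hol_projection (g t) Phi Psi &
        forall p, derive1 (fun s => g s p) t =
                  (eta ^+ 2 / 4) *: map_mx (@complex.Re R) (Psi p)]
}.

(* Main.v *)
Require Import Defs.
From HB Require Import structures.
From mathcomp Require Import all_boot all_order all_algebra.
From mathcomp Require Import all_classical all_reals all_analysis.
From mathcomp Require Import ring lra.
From mathcomp Require Import complex.

Set Implicit Arguments.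
Unset Strict Implicit.
Unset Printing Implicit Defensive.

Import Order.TTheory GRing.Theory Num.Theory numFieldNormedType.Exports.

Local Open Scope classical_set_scope.
Local Open Scope ring_scope.

(** By symmetry the flow is reduced to an ordinary differential equation, and
   the target is designed so that this equation has an explicit solution.

   The target is a bundle of tori, with coordinates (x, y), over a torus with
   coordinates (z, w), and the monodromy around the z-circle is a Dehn twist:
   it is the quotient of R^4 by the group generated by the unit translations in
   x, y and w and by (x, y, z, w) |-> (x - y, y, z + 1, w).  Its metric is
     p (dx + z dy)^2 + 2 e (dx + z dy) dy + p dy^2 + dz^2 / kappa + h dw^2
   where kappa = eta^2 / 2 and p, e, h are functions of (z, w), periodic of
   period 1.  The solution consists of the maps (x, y) |-> (x, y, z(t), w(t))
   onto fibres and of the flat metrics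
     g_a = dx^2 + 2 a dx dy + (a^2 + 1) dy^2 with a = z(t),
   which is g_{a,b} with b = 1.  For these the flow equations become
     a' = kappa e,   z' = - kappa (p_z + e),   w' = - p_w / h
   (tension_target_form, hopf_target_form), so that p_z = - 2 e is needed along
   the trajectory.  There the energy is p, which therefore has to decrease along
   a curve that runs infinitely often around the z-circle.  This is possible for
   a smooth p that is not analytic: along the spiral z = 1 / r, r = sin (2 pi w),
   w -> 0+, one can take
     p = 1 + (1 + r^4 + 4 r^5) e^(-1/r) - e^(-1/r) sin (2 pi (z - 1/r)) / (2 pi)
     e = e^(-1/r) / 2
   for r > 0, continued by p = 1 and e = 0 (fsmooth_flat shows smoothness), and
   h is determined by the w-equation.  What remains is z' = (eta^2 / 4) e^(-z),
   solved by a logarithm (ode_z, ode_w, flow_solution).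

   As a = z tends to infinity, the loops of T^2 in the class (0, 1) become long:
   their squared g_a-length is at least a^2 + 1 (short_loop_flat).  The infimum of
   these lengths is invariant under diffeomorphisms homotopic to the identity and
   bounded on compact subsets of Teichmueller space (compact_loop_sublevel), so
   the metric leaves all of them.  On the other hand g_a and g_{a+1} differ by a
   Dehn twist of T^2, so that in moduli space the curve stays in the image of
   0 <= a <= 1 (flat_moduli_compact), and nonzero lattice vectors have g_a-length
   at least 1, so that the injectivity radius is at least 1/2
   (flat_inj_radius). *)

(** * Smoothness in the sense of Frechet *)

Section calculus.
Variable R : realType.
Implicit Types V W X : normedModType R.

(** Differentiability is required in the sense of Frechet and not only in all
   directions: the chain rule then holds, and closure under composition follows
   by induction. *)
Fixpoint frechet_Ck V W (k : nat) (U : set V) (f : V -> W) {struct k} : Prop :=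
  match k with
  | 0 => forall x, U x -> {for x, continuous f}
  | k'.+1 => (forall x, U x -> differentiable f x) /\
             forall v, frechet_Ck k' U (fun x => 'D_v f x)
  end.

Definition fsmooth V W (U : set V) (f : V -> W) := forall k, frechet_Ck k U f.

Lemma frechet_Ck_Ck V W k (U : set V) (f : V -> W) : frechet_Ck k U f -> Ck k U f.
Proof.
elim: k f => [|k IH] f /=; first by move=> h; split.
move=> [df h]; split=> [x Ux|v]; first exact/differentiable_continuous/df.
by split=> [x Ux|]; [exact/diff_derivable/df | exact/IH/h].
Qed.

Lemma fsmooth_smooth V W (U : set V) (f : V -> W) : fsmooth U f -> smooth U f.
Proof. by move=> h k; exact/frechet_Ck_Ck/h. Qed.

Lemma frechet_Ck_cont V W k (U : set V) (f : V -> W) x :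
  frechet_Ck k U f -> U x -> {for x, continuous f}.
Proof.
by case: k => [h /h//|k] /= [df _] Ux; exact/differentiable_continuous/df.
Qed.

Lemma frechet_CkS V W k (U : set V) (f : V -> W) : frechet_Ck k.+1 U f -> frechet_Ck k U f.
Proof.
elim: k f => [|k IH] f; first by move=> /frechet_Ck_cont h x /h.
by move=> [df h]; split=> // v; exact/IH/h.
Qed.

Lemma fsmooth_cont V W (U : set V) (f : V -> W) x :
  fsmooth U f -> U x -> {for x, continuous f}.
Proof. by move=> /(_ 0%N) h /h. Qed.

Lemma near_eq_derive_near V W (f h : V -> W) (x v : V) :
  (\near x, f x = h x) -> \near x, 'D_v f x = 'D_v h x.
Proof.
by move=> /near_join; apply: filterS => y; exact: near_eq_derive.
Qed.

Lemma diff_littleP V W (f : V -> W) x (L : {linear V -> W}) :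
  continuous L ->
  (forall e : R, 0 < e ->
     \forall h \near 0, `|f (h + x) - (f x + L h)| <= e * `|h|) ->
  is_diff x f L.
Proof.
move=> Lc h; have E : f \o shift x = cst (f x) + L +o_ 0 id by apply/eqaddoP.
have D := diff_unique Lc E; apply: DiffDef => //.
by apply/diff_locallyP; rewrite D.
Qed.

Lemma diff_little V W (f : V -> W) x : differentiable f x ->
  forall e : R, 0 < e ->
     \forall h \near 0, `|f (h + x) - (f x + 'd f x h)| <= e * `|h|.
Proof. by move=> /diff_locally/eqaddoP. Qed.

Lemma near_eq_differentiable V W (f h : V -> W) (x : V) :
  (\near x, f x = h x) -> differentiable h x -> differentiable f x.
Proof.
move=> fh dh; have fx := nbhs_singleton fh.
suff : is_diff x f ('d h x) by move=> [].
apply: diff_littleP => [|e e0]; first exact: diff_continuous.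
have fh0 : \forall y \near 0, f (y + x) = h (y + x).
  by move/nbhs0P: fh; apply: filterS => y; rewrite addrC.
by near=> y; rewrite (near fh0 y)// fx; near: y; exact: (diff_little dh e0).
Unshelve. all: by end_near. Qed.

(** Charts are local inverses of a covering, so that maps read in charts are
   known only near each point; this reduces their smoothness to local models. *)
Lemma frechet_Ck_local V W k (U : set V) (f : V -> W) :
  (forall x, U x -> exists A (h : V -> W),
     [/\ A x, frechet_Ck k A h & \near x, f x = h x]) -> frechet_Ck k U f.
Proof.
elim: k f => [|k IH] f H /=.
  move=> x /H[A [h [Ax hA fh]]].
  suff : f @ x --> h x by rewrite -(nbhs_singleton fh).
  apply: cvg_trans (hA _ Ax); apply: near_eq_cvg.
  by near do apply/esym.
split=> [x /H[A [h [Ax [dh _] fh]]]|v].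
  exact: near_eq_differentiable fh (dh _ Ax).
apply: IH => x /H[A [h [Ax [_ dh] fh]]].
by exists A, ('D_v h); split; [| exact: dh | exact: near_eq_derive_near fh].
Unshelve. all: by end_near. Qed.

Lemma fsmooth_local V W (U : set V) (f : V -> W) :
  (forall x, U x -> exists A (h : V -> W),
     [/\ A x, fsmooth A h & \near x, f x = h x]) -> fsmooth U f.
Proof.
by move=> H k; apply: frechet_Ck_local => x /H[A [h [? ? ?]]]; exists A, h; split.
Qed.

Lemma frechet_Ck_sub V W k (U A : set V) (f : V -> W) :
  U `<=` A -> frechet_Ck k A f -> frechet_Ck k U f.
Proof.
move=> UA; elim: k f => [|k IH] f /=; first by move=> h x /UA/h.
by move=> [df h]; split=> [x /UA/df //|v]; exact: IH.
Qed.

Section open_set.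
Variables (V : normedModType R) (U : set V).
Hypothesis oU : open U.

Lemma frechet_Ck_eq W k (f h : V -> W) : (forall x, U x -> f x = h x) ->
  frechet_Ck k U h -> frechet_Ck k U f.
Proof.
move=> fh hU; apply: frechet_Ck_local => x Ux; exists U, h; split=> //.
by near=> y; apply: fh; near: y; exact: open_nbhs_nbhs.
Unshelve. all: by end_near. Qed.

Lemma frechet_Ck_cst W k (a : W) : frechet_Ck k U (fun=> a).
Proof.
elim: k W a => [|k IH] W a /=; first by move=> x _; exact: cst_continuous.
split=> [x _|v]; first exact: differentiable_cst.
suff -> : (fun x : V => 'D_v (fun=> a) x) = (fun=> 0 : W) by exact: IH.
by apply/funext => x; exact: derive_cst.
Qed.

Lemma frechet_CkD W k (f h : V -> W) : frechet_Ck k U f -> frechet_Ck k U h ->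
  frechet_Ck k U (fun x => f x + h x).
Proof.
elim: k f h => [|k IH] f h /=.
  by move=> cf ch x Ux; apply: continuousD; [exact: cf|exact: ch].
move=> [df Df] [dh Dh]; split=> [x Ux|v].
  by apply: differentiableD; [exact: df|exact: dh].
apply: frechet_Ck_eq (IH _ _ (Df v) (Dh v)) => x Ux.
by rewrite deriveD //; apply/diff_derivable; [exact: df|exact: dh].
Qed.

Lemma frechet_Ck_lin W W' k (L : {linear W -> W'}) (f : V -> W) : continuous L ->
  frechet_Ck k U f -> frechet_Ck k U (fun x => L (f x)).
Proof.
move=> Lc; elim: k f => [|k IH] f /=.
  by move=> cf x Ux; apply: continuous_comp; [exact: cf|exact: Lc].
move=> [df Df]; split=> [x Ux|v].
  by apply: differentiable_comp; [exact: df|exact: linear_differentiable].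
apply: frechet_Ck_eq (IH _ (Df v)) => x Ux.
have dL : differentiable L (f x) by exact: linear_differentiable.
have dfx := df x Ux.
rewrite -[LHS]/('D_v (L \o f) x) (deriveE _ (differentiable_comp dfx dL)).
by rewrite (deriveE _ dfx) (diff_comp dfx dL) /= (diff_lin _ Lc).
Qed.

Lemma frechet_CkM k (f h : V -> R) : frechet_Ck k U f -> frechet_Ck k U h ->
  frechet_Ck k U (fun x => f x * h x).
Proof.
elim: k f h => [|k IH] f h /=.
  by move=> cf ch x Ux; apply: continuousM; [exact: cf|exact: ch].
move=> [df Df] [dh Dh]; split=> [x Ux|v].
  by apply: differentiableM; [exact: df|exact: dh].
have fU : frechet_Ck k U f by apply: frechet_CkS; split.
have hU : frechet_Ck k U h by apply: frechet_CkS; split.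
have A := frechet_CkD (IH _ _ fU (Dh v)) (IH _ _ hU (Df v)).
apply: frechet_Ck_eq A => x Ux.
by rewrite deriveM //; apply/diff_derivable; [exact: df|exact: dh].
Qed.

(** For a scalar inner map the derivative of the composite in the direction v
   is the product of D_v f and g' o f, so that the induction only needs products. *)
Lemma frechet_Ck_comp k (A : set R) (g : R -> R) (f : V -> R) :
  (forall x, U x -> A (f x)) ->
  frechet_Ck k A g -> frechet_Ck k U f -> frechet_Ck k U (fun x => g (f x)).
Proof.
move=> UA; elim: k g f UA => [|k IH] g f UA /=.
  by move=> cg cf x Ux; apply: continuous_comp; [exact: cf|exact/cg/UA].
move=> [dg Dg] [df Df]; split=> [x Ux|v].
  by apply: differentiable_comp; [exact: df|exact/dg/UA].
have fU : frechet_Ck k U f by apply: frechet_CkS; split.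
have B := frechet_CkM (Df v) (IH _ _ UA (Dg 1) fU).
apply: frechet_Ck_eq B => x Ux.
have dfx := df x Ux; have dgx := dg _ (UA x Ux).
rewrite -[LHS]/('D_v (g \o f) x) (deriveE _ (differentiable_comp dfx dgx)).
rewrite (deriveE _ dfx) (deriveE _ dgx) (diff_comp dfx dgx) /=.
by rewrite -[X in 'd g _ X]mulr1 [LHS]linearZ.
Qed.

End open_set.

End calculus.

(** * Building smooth maps *)

Section smooth_closure.
Variable R : realType.
Implicit Types V W : normedModType R.

Lemma fsmooth_linear V W (U : set V) (L : {linear V -> W}) :
  open U -> continuous L -> fsmooth U L.
Proof.
move=> oU Lc [|k]; first by move=> x _; exact: Lc.
split=> [x _|v]; first exact: linear_differentiable.
apply: (frechet_Ck_eq oU) (frechet_Ck_cst U k (L v)) => x _.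
by rewrite deriveE ?diff_lin//; exact: linear_differentiable.
Qed.

Section open_set.
Variables (V : normedModType R) (U : set V).
Hypothesis oU : open U.

Lemma fsmooth_cst W (a : W) : fsmooth U (fun=> a).
Proof. by move=> k; exact: frechet_Ck_cst. Qed.

Lemma fsmoothD W (f h : V -> W) : fsmooth U f -> fsmooth U h ->
  fsmooth U (fun x => f x + h x).
Proof. by move=> F H k; exact: frechet_CkD. Qed.

Lemma fsmoothM (f h : V -> R) : fsmooth U f -> fsmooth U h ->
  fsmooth U (fun x => f x * h x).
Proof. by move=> F H k; exact: frechet_CkM. Qed.

Lemma fsmooth_lin W W' (L : {linear W -> W'}) (f : V -> W) : continuous L ->
  fsmooth U f -> fsmooth U (fun x => L (f x)).
Proof. by move=> Lc F k; exact: frechet_Ck_lin. Qed.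

Lemma fsmooth_comp (A : set R) (g : R -> R) (f : V -> R) :
  fsmooth A g -> (forall x, U x -> A (f x)) -> fsmooth U f ->
  fsmooth U (fun x => g (f x)).
Proof. by move=> G UA F k; exact: (frechet_Ck_comp oU UA (G k) (F k)). Qed.

Lemma fsmooth_eq W (f h : V -> W) : (forall x, U x -> f x = h x) ->
  fsmooth U h -> fsmooth U f.
Proof. by move=> E H k; apply: (frechet_Ck_eq oU) E (H k). Qed.

Lemma fsmoothN (f : V -> R) : fsmooth U f -> fsmooth U (fun x => - f x).
Proof.
move=> F; apply: (@fsmooth_eq _ _ (fun x => -1 * f x)).
  by move=> x _; rewrite mulN1r.
by apply: fsmoothM => //; exact: fsmooth_cst.
Qed.

Lemma fsmoothB (f h : V -> R) : fsmooth U f -> fsmooth U h ->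
  fsmooth U (fun x => f x - h x).
Proof. by move=> F H; apply: fsmoothD => //; exact: fsmoothN. Qed.

Lemma fsmoothX (f : V -> R) n : fsmooth U f -> fsmooth U (fun x => f x ^+ n).
Proof.
move=> F; elim: n => [|n IH].
  by apply: fsmooth_eq (@fsmooth_cst R 1) => x _; rewrite expr0.
by apply: fsmooth_eq (fsmoothM F IH) => x _; rewrite exprS.
Qed.

Lemma fsmoothZ W (f : V -> R) (a : W) : fsmooth U f -> fsmooth U (fun x => f x *: a).
Proof.
move=> F; have sl : linear ( *:%R^~ a : R -> W).
  by move=> k x y; rewrite scalerDl scalerA.
pose lM := GRing.isLinear.Build _ _ _ _ _ sl.
pose L : {linear R -> W} := HB.pack ( *:%R^~ a : R -> W) lM.
by apply: (@fsmooth_lin _ _ L) => //; exact: scalel_continuous.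
Qed.

Lemma fsmooth_sum W (I : Type) (s : seq I) (f : I -> V -> W) :
  (forall i, fsmooth U (f i)) -> fsmooth U (fun x => \sum_(i <- s) f i x).
Proof.
move=> F; elim: s => [|i s IH].
  by apply: fsmooth_eq (@fsmooth_cst W 0) => x _; rewrite big_nil.
by apply: fsmooth_eq (fsmoothD (F i) IH) => x _; rewrite big_cons.
Qed.

Lemma fsmooth_mx m n (f : V -> 'M[R]_(m, n)) :
  (forall i j, fsmooth U (fun x => f x i j)) -> fsmooth U f.
Proof.
move=> F.
apply: (@fsmooth_eq _ _ (fun x => \sum_i \sum_j f x i j *: delta_mx i j)).
  by move=> x _; exact: matrix_sum_delta.
apply: fsmooth_sum => i; apply: fsmooth_sum => j.
exact: fsmoothZ.
Qed.

End open_set.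

Lemma fsmooth_id V (U : set V) : open U -> fsmooth U (fun x => x).
Proof.
by move=> oU; apply: (@fsmooth_linear _ _ U idfun) => // x; exact: cvg_id.
Qed.

Lemma fsmooth_fst V W (U : set (V * W)%type) : open U -> fsmooth U fst.
Proof.
by move=> oU; apply: (@fsmooth_linear (V * W)%type V U fst) => // x; exact: cvg_fst.
Qed.

Lemma fsmooth_snd V W (U : set (V * W)%type) : open U -> fsmooth U snd.
Proof.
by move=> oU; apply: (@fsmooth_linear (V * W)%type W U snd) => // x; exact: cvg_snd.
Qed.

Lemma fsmooth_coord V (U : set V) m n (f : V -> 'M[R]_(m, n)) i j : open U ->
  fsmooth U f -> fsmooth U (fun x => f x i j).
Proof.
move=> oU F.
have @c : {linear 'M[R]_(m, n) -> R}.
  by exists (fun N : 'M[R]_(_, _) => N i j); do 2![eexists]; do ?[constructor];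
     rewrite ?mxE// => ? *; rewrite ?mxE//; move=> ?; rewrite !mxE.
by apply: (@fsmooth_lin _ _ oU _ _ c) => //; exact: coord_continuous.
Qed.

Lemma frechet_Ck_primitive k (A : set R) (f f' : R -> R) : open A ->
  (forall x, A x -> is_derive x 1 f (f' x)) -> frechet_Ck k A f' -> frechet_Ck k.+1 A f.
Proof.
move=> oA D F; split=> [x Ax|v].
  by apply/derivable1_diffP; have [] := D x Ax.
have B := frechet_CkM oA (frechet_Ck_cst A k v) F.
apply: (frechet_Ck_eq oA) B => x Ax; have [dx Dx] := D x Ax.
rewrite deriveE; last exact/derivable1_diffP.
rewrite -[X in 'd f x X]mulr1 [LHS]linearZ -Dx deriveE//.
exact/derivable1_diffP.
Qed.

Lemma frechet_Ck_bootstrap k (A : set R) (f f' : R -> R) : open A ->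
  (forall x, A x -> is_derive x 1 f (f' x)) -> (frechet_Ck k A f -> frechet_Ck k A f') ->
  frechet_Ck k A f -> frechet_Ck k.+1 A f.
Proof. by move=> oA D H F; apply: frechet_Ck_primitive D _ => //; exact: H. Qed.

(** Bootstrapping: if f' is a smooth expression in f, then each degree of
   smoothness of f yields the next one. *)
Lemma fsmooth_ode (A : set R) (f f' : R -> R) : open A ->
  (forall x, A x -> is_derive x 1 f (f' x)) ->
  (forall k, frechet_Ck k A f -> frechet_Ck k A f') -> fsmooth A f.
Proof.
move=> oA D H; elim=> [|k IH]; last exact: frechet_Ck_bootstrap D (H k) IH.
by move=> x Ax; apply: differentiable_continuous; apply/derivable1_diffP; case: (D x Ax).
Qed.

Lemma fsmooth_sin_cos : fsmooth setT (@sin R) /\ fsmooth setT (@cos R).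
Proof.
have H k : frechet_Ck k setT (@sin R) /\ frechet_Ck k setT (@cos R).
  elim: k => [|k [IHs IHc]].
    by split => x _; [exact: continuous_sin|exact: continuous_cos].
  split; first by apply: frechet_Ck_primitive IHc => //; exact: openT.
  have := frechet_CkM openT (frechet_Ck_cst setT k (-1 : R)) IHs.
  apply: frechet_Ck_primitive => [|x _]; first exact: openT.
  by apply: is_derive_eq; rewrite mulN1r.
by split=> k; have [] := H k.
Qed.

Lemma fsmooth_inv : fsmooth [set x : R | 0 < x] (fun x => x^-1).
Proof.
have oA : open [set x : R | 0 < x] by exact: open_gt.
apply: (@fsmooth_ode _ _ (fun x => - (x^-1 * x^-1))) => //.
  move=> x /= x0.
  by apply: is_derive_eq; [apply: is_deriveV; rewrite gt_eqF|
    rewrite scaler1 -exprVn expr2].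
move=> k F.
apply: (@frechet_Ck_eq _ _ _ oA _ k _ (fun x => -1 * (x^-1 * x^-1))).
  by move=> x _; rewrite mulN1r.
by apply: frechet_CkM => //; [exact: frechet_Ck_cst|exact: frechet_CkM].
Qed.

Lemma fsmooth_ln : fsmooth [set x : R | 0 < x] (@ln R).
Proof.
have oA : open [set x : R | 0 < x] by exact: open_gt.
apply: (@fsmooth_ode _ _ (fun x => x^-1)) => //.
by move=> k _; exact: fsmooth_inv.
Qed.

Lemma cos_asin_gt0 (x : R) : -1 < x < 1 -> 0 < cos (asin x).
Proof.
move=> /andP[x1 x2]; rewrite cos_asin ?ltW// sqrtr_gt0.
by nra.
Qed.

Lemma fsmooth_asin : fsmooth [set x : R | -1 < x < 1] (@asin R).
Proof.
have oA : open [set x : R | -1 < x < 1].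
  have -> : [set x : R | -1 < x < 1] = [set` `]-1, 1[] by apply/seteqP; split.
  exact: interval_open.
apply: (@fsmooth_ode _ _ (fun x => (cos (asin x))^-1)) => //.
  move=> x /= x1; rewrite cos_asin; last by case/andP: x1 => /ltW-> /ltW.
  exact: is_derive1_asin.
move=> k F; apply: (frechet_Ck_comp oA _ (fsmooth_inv k)).
  by move=> x /=; exact: cos_asin_gt0.
by apply: (frechet_Ck_comp oA _ (proj2 fsmooth_sin_cos k) F).
Qed.

End smooth_closure.

(** * Flat functions *)

Section flat_functions.
Variable R : realType.

(** A class of expressions, because polynomial growth has to be inherited by
   the derivatives. *)
Inductive tame : (R -> R) -> Prop :=
| tame_cst c : tame (fun=> c)
| tame_id : tame (fun T => T)
| tame_cos : tame (fun T => cos (2 * pi * T))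
| tame_sin : tame (fun T => sin (2 * pi * T))
| tameD g h : tame g -> tame h -> tame (fun T => g T + h T)
| tameM g h : tame g -> tame h -> tame (fun T => g T * h T).

Lemma tame_growth g : tame g ->
  exists C n, 0 <= C /\ forall T, 1 <= T -> `|g T| <= C * T ^+ n.
Proof.
elim=> [c||||f h _ [C [n [C0 H]]] _ [D [m [D0 H']]]|f h _ [C [n [C0 H]]] _ [D [m [D0 H']]]].
- by exists `|c|, 0%N; split=> // T _; rewrite expr0 mulr1.
- exists 1, 1%N; split=> // T T1; rewrite expr1 mul1r ger0_norm//.
  exact: le_trans T1.
- by exists 1, 0%N; split=> // T _; rewrite expr0 mulr1 ler_norml cos_geN1 cos_le1.
- by exists 1, 0%N; split=> // T _; rewrite expr0 mulr1 ler_norml sin_geN1 sin_le1.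
- exists (C + D), (n + m)%N; split=> [|T T1]; first exact: addr_ge0.
  apply: le_trans (ler_normD _ _) _; rewrite mulrDl; apply: lerD.
    apply: le_trans (H T T1) _; apply: ler_wpM2l => //.
    by rewrite ler_weXn2l// leq_addr.
  apply: le_trans (H' T T1) _; apply: ler_wpM2l => //.
  by rewrite ler_weXn2l// leq_addl.
- exists (C * D), (n + m)%N; split=> [|T T1]; first exact: mulr_ge0.
  by rewrite normrM exprD mulrACA; apply: ler_pM => //; [exact: H|exact: H'].
Qed.

Lemma tame_derive g : tame g ->
  exists2 g', tame g' & forall T : R, is_derive T 1 g (g' T).
Proof.
elim=> [c||||f h _ [f' tf F] _ [h' th H]|f h f0 [f' tf F] h0 [h' th H]].
- by exists (fun=> 0) => [|T]; [exact: tame_cst|exact: is_derive_cst].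
- by exists (fun=> 1) => [|T]; [exact: tame_cst|exact: is_derive_id].
- exists (fun T => (- (2 * pi)) * sin (2 * pi * T)) => [|T].
    by apply: tameM; [exact: tame_cst|exact: tame_sin].
  by apply: is_derive_eq; rewrite /GRing.scale/=; ring.
- exists (fun T => (2 * pi) * cos (2 * pi * T)) => [|T].
    by apply: tameM; [exact: tame_cst|exact: tame_cos].
  by apply: is_derive_eq; rewrite /GRing.scale/=; ring.
- exists (fun T => f' T + h' T) => [|T]; first exact: tameD.
  exact: is_deriveD.
- exists (fun T => f' T * h T + f T * h' T) => [|T].
    by apply: tameD; apply: tameM.
  by apply: is_derive_eq; rewrite /GRing.scale/=; ring.
Qed.

Definition flat (g : R -> R) (r : R) : R :=
  if 0 < r then expR (- r^-1) * g r^-1 else 0.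

Lemma flat_gt0 g r : 0 < r -> flat g r = expR (- r^-1) * g r^-1.
Proof. by rewrite /flat => ->. Qed.

Lemma flat_le0 g r : r <= 0 -> flat g r = 0.
Proof. by rewrite /flat ltNge => ->. Qed.

(** The factor r left over after e^(-1/r) has absorbed the polynomial growth
   makes the difference quotient at 0 tend to 0. *)
Lemma flat_bound g : tame g ->
  exists2 C, 0 <= C & forall r, r <= 1 -> `|flat g r| <= C * `|r|.
Proof.
move=> /tame_growth[C [n [C0 H]]].
exists (C * n.+1`!%:R) => [|r r1]; first by rewrite mulr_ge0.
have [r0|r0] := leP r 0; first by rewrite flat_le0// normr0 !mulr_ge0.
rewrite flat_gt0// normrM gtr0_norm ?expR_gt0// (gtr0_norm r0).
have T1 : 1 <= r^-1 by rewrite invf_ge1.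
apply: le_trans (ler_wpM2l (expR_ge0 _) (H _ T1)) _.
have E := @expR_ge1Dxn R r^-1 n (le_trans ler01 T1).
have {}E : r^-1 ^+ n.+1 <= n.+1`!%:R * expR r^-1.
  rewrite mulrC -ler_pdivrMr ?ltr0n ?fact_gt0//.
  by apply: le_trans E; rewrite lerDr.
rewrite mulrCA -mulrA ler_wpM2l// expRN mulrC ler_pdivrMr ?expR_gt0//.
by rewrite mulrAC -ler_pdivrMr// -exprSr.
Qed.

(** In terms of T = 1/r the derivative of e^(-T) g(T) is T^2 (g - g') e^(-T):
   differentiation does not lead out of the class of flat functions. *)
Lemma is_derive_flat g g' : tame g -> (forall T : R, is_derive T 1 g (g' T)) ->
  forall r : R, is_derive r 1 (flat g) (flat (fun T => T * (T * (g T - g' T))) r).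
Proof.
move=> tg D r; have [r0|r0|->] := ltrgtP r 0.
- rewrite flat_le0 ?ltW//.
  apply: (near_eq_is_derive (f := fun=> 0)).
  by near=> x; rewrite flat_le0// ltW//; near: x; exact: lt_nbhsl.
- rewrite flat_gt0//.
  have rn0 : r != 0 by rewrite gt_eqF.
  have Dv : is_derive r 1 (fun x : R => x^-1) (- r ^- 2).
    by apply: is_derive_eq; [exact: is_deriveV|rewrite scaler1].
  have De : is_derive r 1 (fun x : R => expR (- x^-1)) (expR (- r^-1) * r ^- 2).
    apply: (@is_derive1_comp R expR (fun x => - x^-1)).
    by apply: is_derive_eq; rewrite opprK.
  have Dg : is_derive r 1 (fun x : R => g x^-1) (g' r^-1 * - r ^- 2).
    exact: (@is_derive1_comp R g (fun x => x^-1)).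
  have H : is_derive r 1 (fun x : R => expR (- x^-1) * g x^-1)
      (expR (- r^-1) * (r^-1 * (r^-1 * (g r^-1 - g' r^-1)))).
    by apply: is_derive_eq; rewrite /GRing.scale/= -exprVn; ring.
  apply: near_eq_is_derive H.
  by near=> x; rewrite flat_gt0//; near: x; exact: lt_nbhsr.
- rewrite flat_le0//.
  have [C C0 H] := flat_bound (tameM tame_id tg).
  have : is_diff (0 : R) (flat g) (\0 : R -> R).
    apply: (@diff_littleP R R R (flat g) 0 \0) => [x|e e0]; first exact: cst_continuous.
    have C1 : 0 < C + 1 by rewrite ltr_wpDl.
    pose d := Num.min 1 (e / (C + 1)).
    have d0 : 0 < d by rewrite lt_min ltr01 divr_gt0.
    have := @nbhs0_le R R d d0; apply: filterS => h.
    rewrite le_min => /andP[h1 h2].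
    rewrite !addr0 (flat_le0 _ (lexx 0)) /= subr0.
    (* One factor h comes from T = 1 / h, the other from flat_bound. *)
    have -> : flat g h = h * flat (fun T => T * g T) h.
      have [h0|h0] := leP h 0; first by rewrite !flat_le0// mulr0.
      by rewrite !flat_gt0// mulrCA (mulrA h) mulfV ?mul1r ?gt_eqF.
    rewrite normrM mulrC ler_wpM2r//.
    apply: le_trans (H _ (le_trans (ler_norm _) h1)) _.
    apply: (@le_trans _ _ ((C + 1) * `|h|)); first by rewrite ler_wpM2r// lerDl.
    by rewrite mulrC -ler_pdivlMr.
  move=> [dF DF]; split; first exact: diff_derivable.
  by rewrite deriveE// DF.
Unshelve. all: by end_near. Qed.

(** Nothing analytic can replace these functions: the trajectory spirals
   infinitely often, and it is their flatness at 0 that allows this. *)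
Lemma fsmooth_flat g : tame g -> fsmooth setT (flat g).
Proof.
move=> + k; elim: k g => [|k IH] g tg; have [g' tg' D] := tame_derive tg.
  move=> x _; apply: differentiable_continuous; apply/derivable1_diffP.
  by have [] := is_derive_flat tg D x.
apply: (@frechet_Ck_primitive _ _ _ _ (flat (fun T => T * (T * (g T - g' T))))) => [|x _|].
- exact: openT.
- exact: is_derive_flat.
- apply: IH; do 2!(apply: tameM; first exact: tame_id).
  apply: tameD => //.
  rewrite (_ : (fun T => - g' T) = fun T => -1 * g' T); last first.
    by apply/funext => T; rewrite mulN1r.
  by apply: tameM => //; exact: tame_cst.
Qed.

End flat_functions.

(** * The metric of the target *)

Section coordinates.
Variable R : realType.

Definition o0 : 'I_4 := @Ordinal 4 0 isT.
Definition o1 : 'I_4 := @Ordinal 4 1 isT.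
Definition o2 : 'I_4 := @Ordinal 4 2 isT.
Definition o3 : 'I_4 := @Ordinal 4 3 isT.

Lemma ord4P (P : 'I_4 -> Prop) : P o0 -> P o1 -> P o2 -> P o3 -> forall i, P i.
Proof.
move=> ? ? ? ?; case=> [[|[|[|[|//]]]] h];
  by match goal with H : P ?o |- _ =>
    suff -> : Ordinal h = o by []; exact: val_inj end.
Qed.

Lemma sum4 (V : nmodType) (F : 'I_4 -> V) :
  \sum_i F i = F o0 + F o1 + F o2 + F o3.
Proof.
rewrite !big_ord_recl big_ord0 addr0 !addrA.
by congr (F _ + F _ + F _ + F _); exact: val_inj.
Qed.

Lemma ord2P (P : 'I_2 -> Prop) : P 0 -> P 1 -> forall i, P i.
Proof.
move=> ? ?; case=> [[|[|//]] h];
  by match goal with H : P ?o |- _ =>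
    suff -> : Ordinal h = o by []; exact: val_inj end.
Qed.

Lemma sum2 (V : nmodType) (F : 'I_2 -> V) : \sum_i F i = F 0 + F 1.
Proof.
rewrite !big_ord_recl big_ord0 addr0.
by congr (F _ + F _); exact: val_inj.
Qed.

Definition row4 (a b c d : R) : 'rV[R]_4 :=
  \row_i match (i : nat) with 0 => a | 1 => b | 2 => c | _ => d end.

Definition pd_line n (x : 'rV[R]_n) (i : 'I_n) (s : R) : 'rV[R]_n :=
  \row_j (if j == i then s else x 0 j).

(** Gives access to the one-variable differentiation rules. *)
Lemma pdE n (W : normedModType R) (f : 'rV[R]_n -> W) i x :
  pd i f x = 'D_1 (fun s => f (pd_line x i s)) (x 0 i).
Proof.
rewrite /pd /derive.
set g1 := fun h => h^-1 *: _; set g2 := fun h => h^-1 *: _.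
suff -> : g1 = g2 by []; apply/funext => h; rewrite /g1 /g2 /=.
congr (_ *: (f _ - f _)); apply/rowP => j; rewrite !mxE/=; case: eqVneq => [->|_];
  by rewrite /GRing.scale/= ?mulr1 ?mulr0 ?add0r.
Qed.

End coordinates.

Section target_metric.
Variables (R : realType) (kap : R).
Hypothesis kap_gt0 : 0 < kap.

(** The variable r; a periodic function of w, so that functions of r live on
   the circle, and a coordinate near w = 0. *)
Definition sinw (w : R) : R := sin (2 * pi * w).
Definition flat1 (r : R) : R := flat (fun=> 1) r.
Definition flat_cos (r : R) : R := flat (fun T => cos (2 * pi * T)) r.
Definition flat_sin (r : R) : R := flat (fun T => sin (2 * pi * T)) r.

(** The function p, with the oscillating term expanded by the addition formula
   (met_pE).  On the spiral z = 1/r the oscillating term gives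
   p_z = - e^(-1/r), and the correction r^4 + 4 r^5 makes
   p_w = r_w r^2 (1 + 8 r + 20 r^2) e^(-1/r). *)
Definition met_p (z w : R) : R :=
  1 + (1 + sinw w ^+ 4 + 4 * sinw w ^+ 5) * flat1 (sinw w)
  - (2 * pi)^-1 * (sin (2 * pi * z) * flat_cos (sinw w)
                   - cos (2 * pi * z) * flat_sin (sinw w)).

Definition met_e (w : R) : R := flat1 (sinw w) / 2.

(** On the spiral z = 1/r one has w' = z' / z_w, and w' = - p_w / h forces
   h = (2 / kappa) r_w^2 (1 + 8 r + 20 r^2) with r_w^2 = 4 pi^2 (1 - r^2).  This
   vanishes for r = 1 and r = -1; the last term, which is zero for |r| <= 1/2,
   makes h positive there. *)
Definition met_h (w : R) : R :=
  8 * pi ^+ 2 / kap *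
  ((1 - sinw w ^+ 2) * (1 + 8 * sinw w + 20 * sinw w ^+ 2) + flat1 (sinw w ^+ 2 - 4^-1)).

(** P (dx + z dy)^2 + 2 E (dx + z dy) dy + P dy^2 + K dz^2 + H dw^2 *)
Definition sheared_form (P E K H z : R) : 'M[R]_4 :=
  \matrix_(i, j) match (i : nat), (j : nat) with
  | 0, 0 => P
  | 0, 1 | 1, 0 => P * z + E
  | 1, 1 => P * (z ^+ 2 + 1) + 2 * z * E
  | 2, 2 => K
  | 3, 3 => H
  | _, _ => 0
  end.

Definition target_form (x : 'rV[R]_4) : 'M[R]_4 :=
  sheared_form (met_p (x 0 o2) (x 0 o3)) (met_e (x 0 o3)) kap^-1 (met_h (x 0 o3)) (x 0 o2).

Lemma fsmooth_sinw (U : set 'rV[R]_4) : open U -> fsmooth U (fun x => sinw (x 0 o3)).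
Proof.
move=> oU; apply: (fsmooth_comp oU (proj1 (fsmooth_sin_cos R))) => //.
apply: fsmoothM => //; first exact: fsmooth_cst.
by apply: fsmooth_coord => //; exact: fsmooth_id.
Qed.

Lemma tame_cst1 : tame (fun=> 1 : R). Proof. exact: tame_cst. Qed.

Lemma fsmooth_target_form : fsmooth setT target_form.
Proof.
have oT := @openT 'rV[R]_4.
have cst a : fsmooth [set: 'rV[R]_4] (fun=> a : R) by exact: fsmooth_cst.
have Z : fsmooth [set: 'rV[R]_4] (fun x => x 0 o2).
  by apply: fsmooth_coord => //; exact: fsmooth_id.
have r := fsmooth_sinw oT.
have FA (f : 'rV[R]_4 -> R) : fsmooth setT f -> fsmooth setT (fun x => flat1 (f x)).
  by apply: (fsmooth_comp oT (fsmooth_flat tame_cst1)).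
have FC : fsmooth [set: 'rV[R]_4] (fun x => flat_cos (sinw (x 0 o3))).
  by apply: (fsmooth_comp oT (fsmooth_flat (tame_cos _))).
have FS : fsmooth [set: 'rV[R]_4] (fun x => flat_sin (sinw (x 0 o3))).
  by apply: (fsmooth_comp oT (fsmooth_flat (tame_sin _))).
have S : fsmooth [set: 'rV[R]_4] (fun x => sin (2 * pi * x 0 o2)).
  by apply: (fsmooth_comp oT (proj1 (fsmooth_sin_cos R))) => //; exact: fsmoothM.
have C : fsmooth [set: 'rV[R]_4] (fun x => cos (2 * pi * x 0 o2)).
  by apply: (fsmooth_comp oT (proj2 (fsmooth_sin_cos R))) => //; exact: fsmoothM.
have P : fsmooth [set: 'rV[R]_4] (fun x => met_p (x 0 o2) (x 0 o3)).
  rewrite /met_p.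
  repeat (first [ apply: fsmoothB | apply: fsmoothD | apply: fsmoothM
                | apply: fsmoothX ]; try exact: oT) => //.
  exact: FA.
have E : fsmooth [set: 'rV[R]_4] (fun x => met_e (x 0 o3)).
  by rewrite /met_e; apply: fsmoothM => //; exact: FA.
have H : fsmooth [set: 'rV[R]_4] (fun x => met_h (x 0 o3)).
  rewrite /met_h.
  apply: fsmoothM => //; apply: fsmoothD => //; last first.
    by apply: FA; apply: fsmoothB => //; exact: fsmoothX.
  apply: fsmoothM => //; first by apply: fsmoothB => //; exact: fsmoothX.
  apply: fsmoothD => //; first by apply: fsmoothD => //; exact: fsmoothM.
  by apply: fsmoothM => //; exact: fsmoothX.
apply: (fsmooth_mx oT) => i j.
apply: (fsmooth_eq oT (h := fun x => match (i : nat), (j : nat) with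
  | 0, 0 => met_p (x 0 o2) (x 0 o3)
  | 0, 1 | 1, 0 => met_p (x 0 o2) (x 0 o3) * (x 0 o2) + met_e (x 0 o3)
  | 1, 1 => met_p (x 0 o2) (x 0 o3) * ((x 0 o2) ^+ 2 + 1) + 2 * (x 0 o2) * met_e (x 0 o3)
  | 2, 2 => kap^-1
  | 3, 3 => met_h (x 0 o3)
  | _, _ => 0
  end)); first by move=> x _; rewrite mxE.
move: i j; apply: ord4P; apply: ord4P => //=.
- by apply: fsmoothD => //; exact: fsmoothM.
- by apply: fsmoothD => //; exact: fsmoothM.
- apply: fsmoothD => //; apply: fsmoothM => //; last exact: fsmoothM.
  by apply: fsmoothD => //; exact: fsmoothX.
Qed.

Lemma flat1_ge0 r : 0 <= flat1 r.
Proof. by rewrite /flat1 /flat; case: ifP => // _; rewrite mulr1 expR_ge0. Qed.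

Lemma flat1_le1 r : flat1 r <= 1.
Proof.
rewrite /flat1 /flat; case: ifP => // r0.
by rewrite mulr1 -expR0 ler_expR oppr_le0 invr_ge0 ltW.
Qed.

Lemma flat_cosE r : flat_cos r = flat1 r * cos (2 * pi * r^-1).
Proof. by rewrite /flat_cos /flat1 /flat; case: ifP; rewrite ?mul0r// mulr1. Qed.

Lemma flat_sinE r : flat_sin r = flat1 r * sin (2 * pi * r^-1).
Proof. by rewrite /flat_sin /flat1 /flat; case: ifP; rewrite ?mul0r// mulr1. Qed.

Lemma met_pE z w :
  met_p z w = 1 + (1 + sinw w ^+ 4 + 4 * sinw w ^+ 5) * flat1 (sinw w)
  - (2 * pi)^-1 * flat1 (sinw w) * sin (2 * pi * z - 2 * pi * (sinw w)^-1).
Proof. by rewrite /met_p flat_cosE flat_sinE sinB; congr (_ - _); ring. Qed.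

(** The fibre form is definite: p >= 1 - 1/4 and e <= 1/2. *)
Lemma met_e_lt_p z w : met_e w < met_p z w.
Proof.
rewrite met_pE /met_e.
have pi2 : 2 <= pi :> R := pi_ge2 R.
have a0 := flat1_ge0 (sinw w); have a1 := flat1_le1 (sinw w).
have : 0 <= (1 + sinw w ^+ 4 + 4 * sinw w ^+ 5) * flat1 (sinw w).
  have [r0|r0] := leP (sinw w) 0; first by rewrite /flat1 flat_le0// mulr0.
  by rewrite mulr_ge0// !addr_ge0// ?exprn_ge0 ?mulr_ge0 ?exprn_ge0 ?ltW.
have p0 : 0 < 2 * pi :> R by lra.
have q0 : 0 < (2 * pi)^-1 :> R by rewrite invr_gt0.
have q1 : (2 * pi)^-1 <= 4^-1 :> R by rewrite lef_pV2 ?posrE//; lra.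
have : (2 * pi)^-1 * flat1 (sinw w) * sin (2 * pi * z - 2 * pi * (sinw w)^-1) <= 4^-1.
  apply: (@le_trans _ _ ((2 * pi)^-1 * flat1 (sinw w) * 1)).
    by rewrite ler_wpM2l ?sin_le1// mulr_ge0// ltW.
  rewrite mulr1 -[leRHS]mulr1; apply: ler_pM => //; exact: ltW.
lra.
Qed.

Lemma met_h_gt0 w : 0 < met_h w.
Proof.
rewrite /met_h; apply: mulr_gt0.
  by rewrite !mulr_gt0 ?invr_gt0 ?pi_gt0.
have r1 : sinw w ^+ 2 <= 1.
  have := sin_geN1 (2 * pi * w); have := sin_le1 (2 * pi * w).
  by rewrite -/(sinw w); nra.
have q0 : 0 < 1 + 8 * sinw w + 20 * sinw w ^+ 2.
  by have := sqr_ge0 (sinw w + 5^-1); nra.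
have [h|h] := ltP (sinw w ^+ 2) 1.
  by rewrite ltr_wpDr ?flat1_ge0// mulr_gt0// subr_gt0.
rewrite ltr_wpDl//; first by rewrite mulr_ge0 ?subr_ge0// ltW.
rewrite /flat1 flat_gt0 ?mulr1 ?expR_gt0//; lra.
Qed.

Lemma met_e_ge0 w : 0 <= met_e w.
Proof. by rewrite /met_e divr_ge0 ?flat1_ge0. Qed.

Lemma sheared_form_quad (P E K H z : R) (v : 'rV[R]_4) :
  (v *m sheared_form P E K H z *m v^T) 0 0 =
  (P - E) * ((v 0 o0 + z * v 0 o1) ^+ 2 + v 0 o1 ^+ 2)
  + E * (v 0 o0 + z * v 0 o1 + v 0 o1) ^+ 2 + K * v 0 o2 ^+ 2 + H * v 0 o3 ^+ 2.
Proof. by rewrite !mxE sum4 !mxE !sum4 !mxE/=; ring. Qed.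

Lemma shifted_squares_gt0 (D E K H A B c d : R) : 0 < D -> 0 <= E -> 0 < K -> 0 < H ->
  [|| A != 0, B != 0, c != 0 | d != 0] ->
  0 < D * (A ^+ 2 + B ^+ 2) + E * (A + B) ^+ 2 + K * c ^+ 2 + H * d ^+ 2.
Proof.
move=> D0 E0 K0 H0 nz.
have AB : 0 <= A ^+ 2 + B ^+ 2 by rewrite addr_ge0 ?sqr_ge0.
have d1 : 0 <= D * (A ^+ 2 + B ^+ 2) by rewrite mulr_ge0// ltW.
have d2 : 0 <= E * (A + B) ^+ 2 by rewrite mulr_ge0// sqr_ge0.
have d3 : 0 <= K * c ^+ 2 by rewrite mulr_ge0 ?sqr_ge0// ltW.
have d4 : 0 <= H * d ^+ 2 by rewrite mulr_ge0 ?sqr_ge0// ltW.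
rewrite lt_def !addr_ge0// andbT; apply: contraL nz.
rewrite (paddr_eq0 _ d4) ?addr_ge0// (paddr_eq0 _ d3) ?addr_ge0//.
rewrite (paddr_eq0 d1 d2) !mulf_eq0 (gt_eqF D0) (gt_eqF K0) (gt_eqF H0)/=.
rewrite paddr_eq0 ?sqr_ge0// !sqrf_eq0 ?orbb.
by move=> /andP[/andP[/andP[/andP[-> ->] _] ->] ->].
Qed.

Lemma spd_target_form x : spd (target_form x).
Proof.
split.
  by apply/matrixP; apply: ord4P; apply: ord4P; rewrite !mxE.
move=> v v0; rewrite sheared_form_quad; apply: shifted_squares_gt0.
- by rewrite subr_gt0 met_e_lt_p.
- exact: met_e_ge0.
- by rewrite invr_gt0.
- exact: met_h_gt0.
apply: contra_neqT v0; rewrite !negb_or !negbK => /and4P[/eqP A /eqP B /eqP C /eqP D].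
by apply/rowP; apply: ord4P; rewrite mxE// -A B mulr0 addr0.
Qed.

End target_metric.

(** * The deck group *)

Section affine.
Variable R : realType.

Lemma pd_affine p q (f : 'rV[R]_p -> 'rV[R]_q) (A : 'M[R]_(p, q)) (b : 'rV[R]_q) :
  (forall x, f x = x *m A + b) -> forall i x, pd i f x = row i A.
Proof.
move=> fE i x; have -> : f = (fun x => x *m A + b) by apply/funext.
have E : (fun h => h^-1 *: (((h *: delta_mx 0 i + x) *m A + b) - (x *m A + b)))
    @ (0:R)^' --> row i A.
  apply: cvg_near_cst; near=> h.
  have h0 : h != 0 by near: h; exact: nbhs_dnbhs_neq.
  rewrite opprD addrACA subrr addr0 mulmxDl addrK -scalemxAl scalerA mulVf//.
  by rewrite scale1r rowE.
exact: cvg_lim E.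
Unshelve. all: by end_near. Qed.

Lemma Jac_affine p q (f : 'rV[R]_p -> 'rV[R]_q) (A : 'M[R]_(p, q)) (b : 'rV[R]_q) :
  (forall x, f x = x *m A + b) -> forall x, Jac f x = A.
Proof.
by move=> fE x; apply/matrixP => i j; rewrite mxE (pd_affine fE) mxE.
Qed.

Lemma fsmooth_affine p q (f : 'rV[R]_p -> 'rV[R]_q) (A : 'M[R]_(p, q)) (b : 'rV[R]_q) :
  (forall x, f x = x *m A + b) -> fsmooth setT f.
Proof.
move=> fE; have oT := @openT 'rV[R]_p; apply: (fsmooth_mx oT) => i j.
apply: (fsmooth_eq oT (h := fun x => \sum_k x i k * A k j + b i j)).
  by move=> x _; rewrite fE !mxE.
apply: fsmoothD => //; last exact: fsmooth_cst.
apply: fsmooth_sum => // k; apply: fsmoothM => //; last exact: fsmooth_cst.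
by apply: fsmooth_coord => //; exact: fsmooth_id.
Qed.

End affine.

Section deck_group.
Variable R : realType.
Implicit Types (x y : 'rV[R]_4) (m n k l : int).

(** The form dx + z dy is invariant, as z increases by k while x decreases
   by k y. *)
Definition act m n k l x : 'rV[R]_4 :=
  row4 (x 0 o0 - k%:~R * x 0 o1 + m%:~R) (x 0 o1 + n%:~R)
       (x 0 o2 + k%:~R) (x 0 o3 + l%:~R).

Lemma act0 x : act 0 0 0 0 x = x.
Proof. by apply/rowP; apply: ord4P; rewrite !mxE/= ?mul0r ?subr0 addr0. Qed.

Lemma act_comp m n k l m' n' k' l' x :
  act m' n' k' l' (act m n k l x) =
  act (m + m' - k' * n) (n + n') (k + k') (l + l') x.
Proof.
by apply/rowP; apply: ord4P; rewrite !mxE/= ?(intrD, rmorphN, rmorphM)/=; ring.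
Qed.

Lemma actK m n k l : cancel (act m n k l) (act (- m - k * n) (- n) (- k) (- l)).
Proof.
move=> x; rewrite act_comp -[RHS]act0; congr (act _ _ _ _ x); ring.
Qed.

Definition deck_mx k : 'M[R]_4 :=
  \matrix_(i, j) match (i : nat), (j : nat) with
  | 1, 0 => - k%:~R
  | 0, 0 | 1, 1 | 2, 2 | 3, 3 => 1
  | _, _ => 0
  end.

Definition deck_shift m n k l : 'rV[R]_4 := row4 m%:~R n%:~R k%:~R l%:~R.

Lemma actE m n k l x : act m n k l x = x *m deck_mx k + deck_shift m n k l.
Proof.
by apply/rowP; apply: ord4P; rewrite !mxE/= sum4 !mxE/=; ring.
Qed.

Lemma sinDint (a : R) k : sin (a + 2 * pi * k%:~R) = sin a.
Proof.
have N (j : nat) (b : R) : sin (b + 2 * pi * j%:R) = sin b.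
  rewrite -[RHS](periodicn (@sinD2pi R) j); congr (sin (_ + _)).
  by rewrite -[in RHS]mulr_natr -[pi *+ 2]mulr_natl.
case: k => j; first exact: N.
by rewrite NegzE rmorphN/= mulrN -[LHS](N j.+1) subrK.
Qed.

Lemma sinwD (w : R) l : sinw (w + l%:~R) = sinw w.
Proof. by rewrite /sinw (mulrDr (2 * pi)) sinDint. Qed.

Lemma met_pD (z w : R) k l : met_p (z + k%:~R) (w + l%:~R) = met_p z w.
Proof. by rewrite !met_pE sinwD (mulrDr (2 * pi)) (addrAC (2 * pi * z)) sinDint. Qed.

Lemma met_eD (w : R) l : met_e (w + l%:~R) = met_e w.
Proof. by rewrite /met_e sinwD. Qed.

Lemma met_hD (kap w : R) l : met_h kap (w + l%:~R) = met_h kap w.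
Proof. by rewrite /met_h sinwD. Qed.

Lemma sheared_form_deck (P E K H z : R) k :
  deck_mx k *m sheared_form P E K H (z + k%:~R) *m (deck_mx k)^T = sheared_form P E K H z.
Proof.
apply/matrixP; apply: ord4P; apply: ord4P;
  rewrite !mxE !sum4 !mxE !sum4 !mxE/=; ring.
Qed.

Lemma target_form_act (kap : R) m n k l x :
  deck_mx k *m target_form kap (act m n k l x) *m (deck_mx k)^T = target_form kap x.
Proof.
rewrite -[RHS](sheared_form_deck _ _ _ _ _ k) /target_form; congr (_ *m _ *m _).
by rewrite !mxE/= met_pD met_eD met_hD.
Qed.

Lemma fsmooth_act m n k l : fsmooth setT (act m n k l : 'rV[R]_4 -> _).
Proof. exact: fsmooth_affine (actE m n k l). Qed.

Lemma Jac_act m n k l x : Jac (act m n k l) x = deck_mx k.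
Proof. exact: Jac_affine (actE m n k l) x. Qed.

Lemma act_cont m n k l : continuous (act m n k l : 'rV[R]_4 -> _).
Proof. by move=> x; apply: (fsmooth_cont (fsmooth_act m n k l)). Qed.

End deck_group.

(** * The quotient of R^4 by the deck group *)

Local Open Scope quotient_scope.

Section quotient_manifold.
Variable R : realType.
Implicit Types (x y : 'rV[R]_4) (m n k l : int).

Definition deck x y : Prop := exists m n k l, y = act m n k l x.

Lemma deck_refl : reflexive (fun x y => `[< deck x y >]).
Proof. by move=> x; apply/asboolP; exists 0, 0, 0, 0; rewrite act0. Qed.

Lemma deck_sym : symmetric (fun x y => `[< deck x y >]).
Proof.
have H x y : deck x y -> deck y x.
  move=> [m [n [k [l ->]]]]; exists (- m - k * n), (- n), (- k), (- l).
  by rewrite actK.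
by move=> x y; apply/asboolP/asboolP; exact: H.
Qed.

Lemma deck_trans : transitive (fun x y => `[< deck x y >]).
Proof.
move=> y x z /asboolP[m [n [k [l ->]]]] /asboolP[m' [n' [k' [l' ->]]]].
apply/asboolP; exists (m + m' - k' * n), (n + n'), (k + k'), (l + l').
exact: act_comp.
Qed.

Definition deck_rel : equiv_rel 'rV[R]_4 :=
  EquivRel (fun x y => `[< deck x y >]) deck_refl deck_sym deck_trans.

Definition orbits : topologicalType := quotient_topology {eq_quot deck_rel}.

Definition prj x : orbits := \pi_({eq_quot deck_rel}) x.

Lemma prjP x y : prj x = prj y <-> deck x y.
Proof.
split; first by move=> /eqmodP/asboolP.
by move=> h; apply/eqmodP/asboolP.
Qed.

Lemma prj_act m n k l x : prj (act m n k l x) = prj x.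
Proof. by apply/esym/prjP; exists m, n, k, l. Qed.

Lemma prj_surj (q : orbits) : exists x, prj x = q.
Proof. by exists (repr (q : {eq_quot deck_rel})); exact: reprK. Qed.

Lemma prj_cont : continuous prj.
Proof. exact: pi_continuous. Qed.

Lemma prj_open (A : set 'rV[R]_4) : open A -> open (prj @` A).
Proof.
move=> oA.
have -> : open (prj @` A) = open (prj @^-1` (prj @` A)) by [].
have -> : prj @^-1` (prj @` A) = \bigcup_(g in [set: int * int * int * int])
    (act g.1.1.1 g.1.1.2 g.1.2 g.2 @^-1` A).
  apply/seteqP; split=> x /=.
    move=> [y Ay /esym/prjP[m [n [k [l E]]]]].
    by exists (m, n, k, l) => //=; rewrite -E.
  move=> [[[[m n] k] l] _ /= Ax]; exists (act m n k l x) => //.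
  exact: prj_act.
apply: bigcup_open => g _; apply: open_comp => // y _; exact: act_cont.
Qed.

Lemma rV_ballP (d : nat) (x y : 'rV[R]_d) e : 0 < e ->
  ball x e y <-> forall i, `|x 0 i - y 0 i| < e.
Proof.
move=> e0; split=> [[_ h] i|h]; first exact: (h 0 i).
by split=> // i j; rewrite (ord1 i); exact: h.
Qed.

Lemma int_small k : `|k%:~R : R| < 1 -> k = 0.
Proof.
rewrite -intr_norm -[1]/(1%:~R) ltr_int -[X in _ < X]add0r ltzD1 normr_le0.
by move/eqP.
Qed.

Lemma int_eq_small k k' : `|k%:~R - k'%:~R : R| < 1 -> k = k'.
Proof. by rewrite -rmorphB/= => /int_small/subr0_eq. Qed.

(** Proper discontinuity.  Because of the twist, the displacement in x involves
   k y, so that the size of the neighbourhoods has to depend on a bound for k,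
   obtained from the displacement in z. *)
Lemma deck_rigid x y : exists2 e : R, 0 < e & forall x1 x2 m n k l m' n' k' l',
  ball x e x1 -> ball x e x2 -> ball y e (act m n k l x1) ->
  ball y e (act m' n' k' l' x2) -> [/\ m = m', n = n', k = k' & l = l'].
Proof.
(* D bounds |k|, and the radius e satisfies 8 e + 4 D e = 1. *)
pose D := `|x 0 o2 - y 0 o2| + 1; have D0 : 0 <= D by rewrite addr_ge0.
have e0 : 0 < (8 + 4 * D)^-1 by rewrite invr_gt0; lra.
exists (8 + 4 * D)^-1 => // x1 x2 m n k l m' n' k' l'.
set e := (8 + 4 * D)^-1 in e0 *.
have e1 : 8 * e + 4 * (D * e) = 1.
  by rewrite mulrA -mulrDl /e mulfV// gt_eqF//; lra.
have De : 0 <= D * e by rewrite mulr_ge0// ltW.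
move=> /(rV_ballP _ _ e0) A /(rV_ballP _ _ e0) B /(rV_ballP _ _ e0) A'
  /(rV_ballP _ _ e0) B'.
have pos (i j : int) (a b : R) : `|a| < 2 * e -> `|b| < 2 * e ->
    i%:~R - j%:~R = a - b -> i = j.
  move=> ha hb E; apply: int_eq_small; rewrite E.
  by move: ha hb; rewrite !ltr_norml => /andP[? ?] /andP[? ?]; apply/andP; split; lra.
have two (a b : R) : `|a| < e -> `|b| < e -> `|a - b| < 2 * e.
  rewrite !ltr_norml => /andP[? ?] /andP[? ?]; apply/andP; split; lra.
have nn : n = n'.
  apply: (pos _ _ ((x 0 o1 - x1 0 o1) - (y 0 o1 - act m n k l x1 0 o1))
   ((x 0 o1 - x2 0 o1) - (y 0 o1 - act m' n' k' l' x2 0 o1))); try exact: two.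
  by rewrite !mxE/=; ring.
have kk : k = k'.
  apply: (pos _ _ ((x 0 o2 - x1 0 o2) - (y 0 o2 - act m n k l x1 0 o2))
   ((x 0 o2 - x2 0 o2) - (y 0 o2 - act m' n' k' l' x2 0 o2))); try exact: two.
  by rewrite !mxE/=; ring.
have ll : l = l'.
  apply: (pos _ _ ((x 0 o3 - x1 0 o3) - (y 0 o3 - act m n k l x1 0 o3))
   ((x 0 o3 - x2 0 o3) - (y 0 o3 - act m' n' k' l' x2 0 o3))); try exact: two.
  by rewrite !mxE/=; ring.
split=> //; subst n' k' l'.
have kD : `|k%:~R : R| <= D.
  rewrite /D; have := A o2; have := A' o2; rewrite !mxE/=.
  have := ler_norm (x 0 o2 - y 0 o2); have := ler_norm (- (x 0 o2 - y 0 o2)).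
  rewrite normrN ler_norml !ltr_norml => ? ? /andP[? ?] /andP[? ?].
  by apply/andP; split; lra.
apply: int_eq_small.
have -> : m%:~R - m'%:~R = ((x 0 o0 - x1 0 o0) - (y 0 o0 - act m n k l x1 0 o0))
   - ((x 0 o0 - x2 0 o0) - (y 0 o0 - act m' n k l x2 0 o0))
   - k%:~R * ((x 0 o1 - x1 0 o1) - (x 0 o1 - x2 0 o1)).
  by rewrite !mxE/=; ring.
have K : `|k%:~R * ((x 0 o1 - x1 0 o1) - (x 0 o1 - x2 0 o1))| <= D * (2 * e).
  by rewrite normrM; apply: ler_pM => //; apply: ltW; exact: two.
have P := two _ _ (A o0) (A' o0); have Q := two _ _ (B o0) (B' o0).
move: K P Q; rewrite ler_norml !ltr_norml.
by move=> /andP[? ?] /andP[? ?] /andP[? ?]; apply/andP; split; lra.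
Qed.

Lemma act_fixed_small x m n k l : ball x 1 (act m n k l x) ->
  [/\ m = 0, n = 0, k = 0 & l = 0].
Proof.
move=> /(rV_ballP _ _ ltr01) H.
have k0 : k = 0.
  by apply: int_small; have := H o2; rewrite !mxE/= opprD addrA subrr sub0r normrN.
have n0 : n = 0.
  by apply: int_small; have := H o1; rewrite !mxE/= opprD addrA subrr sub0r normrN.
have l0 : l = 0.
  by apply: int_small; have := H o3; rewrite !mxE/= opprD addrA subrr sub0r normrN.
split=> //; subst k; apply: int_small; have := H o0.
by rewrite !mxE/= mul0r subr0 opprD addrA subrr sub0r normrN.
Qed.

(** If the orbits of x and y cannot be separated, the single transformation
   provided by deck_rigid moves points arbitrarily close to x arbitrarily close
   to y, hence x to y. *)
Lemma orbits_hausdorff : hausdorff_space orbits.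
Proof.
move=> p q; have [x <-] := prj_surj p; have [y <-] := prj_surj q => cl.
have [e e0 rigid] := deck_rigid x y.
have near_pair (d : R) : 0 < d -> exists x1 m n k l,
    ball x d x1 /\ ball y d (act m n k l x1).
  move=> d0.
  have nb z : nbhs (prj z) (prj @` ball z d).
    apply: open_nbhs_nbhs; split; first by apply: prj_open; exact: ball_open.
    by exists z => //; exact: ballxx.
  have [_ [[x1 bx <-] [y1 by1]]] := cl _ _ (nb x) (nb y).
  move=> /esym/prjP[m [n [k [l E]]]].
  by exists x1, m, n, k, l; rewrite -E.
have [x1 [m [n [k [l [b1 b2]]]]]] := near_pair e e0.
suff -> : y = act m n k l x by rewrite prj_act.
apply: (@norm_hausdorff _ 'rV[R]_4) => A B yA B'.
have cB : nbhs x (act m n k l @^-1` B) by apply: act_cont.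
move/nbhs_ballP: yA => [d1 d10 h1]; move/nbhs_ballP: cB => [d2 d20 h2].
pose d := Num.min e (Num.min d1 d2).
have d0 : 0 < d by rewrite !lt_min e0 d10 d20.
have [x2 [m' [n' [k' [l' [c1 c2]]]]]] := near_pair d d0.
have le (z z' : 'rV[R]_4) (f : R) : d <= f -> ball z d z' -> ball z f z'.
  by move=> df; exact: (le_ball df).
have de : d <= e by rewrite ge_min lexx.
have [E1 E2 E3 E4] := rigid _ _ _ _ _ _ _ _ _ _ b1 (le _ _ _ de c1) b2 (le _ _ _ de c2).
subst m' n' k' l'; exists (act m n k l x2); split.
  by apply: h1; apply: le c2; rewrite !ge_min lexx orbT.
by apply: h2; apply: le c1; rewrite !ge_min lexx !orbT.
Qed.

Lemma orbits_compact : compact [set: orbits].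
Proof.
have -> : [set: orbits] = prj @` [set v : 'rV[R]_4 | forall i, `[0, 1]%classic (v ord0 i)].
  apply/seteqP; split=> // q _; have [x <-] := prj_surj q.
  (* x is reduced last, because the reduction of z shifts it by k y. *)
  pose k := - Num.floor (x 0 o2); pose n := - Num.floor (x 0 o1).
  pose l := - Num.floor (x 0 o3); pose m := - Num.floor (x 0 o0 - k%:~R * x 0 o1).
  exists (act m n k l x); last exact: prj_act.
  have fl01 (a : R) : a + (- Num.floor a)%:~R \in `[0, 1].
    rewrite in_itv/= rmorphN subr_ge0 floor_le/= lerBlDl.
    by have := ltW (floorD1_gt a); rewrite rmorphD/=.
  by apply: ord4P; rewrite !mxE/=; exact: fl01.
apply: continuous_compact; first by apply: continuous_subspaceT; exact: prj_cont.
apply: (@rV_compact R 4 (fun=> `[0, 1]%classic)) => i.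
exact: segment_compact.
Qed.

(** The projection is open, so the images of the balls with rational centre and
   radius 1 / (n + 1) form a basis. *)
Lemma orbits_second_countable : @second_countable orbits.
Proof.
pose B (z : 'rV[rat]_4 * nat) : set orbits :=
  prj @` ball (map_mx ratr z.1 : 'rV[R]_4) z.2.+1%:R^-1.
exists (range B); first exact: sub_countable (card_image_le _ _) (countableP _).
split=> [_ [z _ <-]|p V Vp].
  by apply: prj_open; exact: ball_open.
have [x E] := prj_surj p; subst p.
have /nbhs_ballP[e e0 be] : nbhs x (prj @^-1` V) by apply: prj_cont.
have [N N0] : exists N : nat, N.+1%:R^-1 < e / 2 :> R.
  have e2 : 0 < e / 2 by exact: divr_gt0.
  have [N _ h] := near_infty_natSinv_lt (PosNum e2).
  by exists N; exact: (h N (leqnn N)).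
have [d dN d0] : exists2 d : R, d = N.+1%:R^-1 & 0 < d.
  by exists N.+1%:R^-1; rewrite ?invr_gt0 ?ltr0n.
rewrite -dN in N0.
have H (i : 'I_4) : exists q : rat, `|x 0 i - ratr q| < d.
  have [|q] := @rat_in_itvoo R (x 0 i - d) (x 0 i + d); first lra.
  rewrite in_itv/= => /andP[? ?]; exists q; rewrite ltr_norml; apply/andP; split; lra.
have [q qE] := choice H.
pose z : 'rV[rat]_4 * nat := (\row_i q i, N).
have xz : ball (map_mx ratr z.1 : 'rV[R]_4) d x.
  by apply/(rV_ballP _ _ d0) => i; rewrite distrC !mxE.
exists (B z).
  split; first by exists z.
  by exists x => //; rewrite -dN.
move=> _ [y + <-]; rewrite -dN => yb; apply: be; apply/(rV_ballP _ _ e0) => i.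
move/(rV_ballP _ _ d0): xz => /(_ i); move/(rV_ballP _ _ d0): yb => /(_ i).
rewrite !ltr_norml => /andP[? ?] /andP[? ?]; apply/andP; split; lra.
Qed.

End quotient_manifold.
Arguments prj {R} x.

(** * The target manifold *)

Section charts.
Variable R : realType.
Implicit Types (x y p : 'rV[R]_4) (m n k l : int).

Definition chart_box p : set 'rV[R]_4 := ball p 2^-1.

Lemma chart_box_open p : open (chart_box p). Proof. exact: ball_open. Qed.

Lemma chart_box_ctr p : chart_box p p. Proof. by apply: ballxx; rewrite invr_gt0. Qed.

(** Two points of a box of side 1 differ by less than 1 in each coordinate, and
   only the trivial deck transformation moves a point that little. *)
Lemma chart_box_inj p x y : chart_box p x -> chart_box p y -> prj x = prj y -> x = y.
Proof.
move=> bx by_ /prjP[m [n [k [l E]]]].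
have b1 : ball x 1 (act m n k l x).
  by rewrite -E (splitr 1) div1r; exact: ball_triangle (ball_sym bx) by_.
have [m0 n0 k0 l0] := act_fixed_small b1.
by rewrite E m0 n0 k0 l0 act0.
Qed.

Definition sheet p (q : orbits R) : 'rV[R]_4 := get [set x | chart_box p x /\ prj x = q].

Lemma sheet_prj p x : chart_box p x -> sheet p (prj x) = x.
Proof.
move=> bx; have [b E] : [set y | chart_box p y /\ prj y = prj x] (sheet p (prj x)).
  by apply: (@getI _ _ x).
exact: chart_box_inj b bx E.
Qed.

Lemma sheet_img p : sheet p @` (prj @` chart_box p) = chart_box p.
Proof.
apply/seteqP; split=> [_ [_ [x bx <-] <-]|x bx]; first by rewrite sheet_prj.
by exists (prj x); [exists x|rewrite sheet_prj].
Qed.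

Lemma sheet_cont p q : (prj @` chart_box p) q -> {for q, continuous (sheet p)}.
Proof.
move=> [x bx <-] A; rewrite sheet_prj// => Ax.
have : nbhs x (A `&` chart_box p).
  by apply: filterI => //; apply: open_nbhs_nbhs; split => //; exact: chart_box_open.
rewrite nbhsE => -[B [oB Bx] BA].
have : nbhs (prj x) (prj @` B).
  by apply: open_nbhs_nbhs; split; [exact: prj_open|exists x].
by apply: filterS => _ [y /BA[Ay cy] <-] /=; rewrite sheet_prj.
Qed.

Lemma sheet_imgo p : open (sheet p @` (prj @` chart_box p)).
Proof. by rewrite sheet_img; exact: chart_box_open. Qed.

Lemma sheetK p q : (prj @` chart_box p) q -> prj (sheet p q) = q.
Proof. by move=> [x bx <-]; rewrite sheet_prj. Qed.

(** The inverse of a chart is the covering projection, restricted to a box.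
   Hence transition maps are locally deck transformations, and an invariant
   metric on R^4 has the same coefficients in all charts. *)
Definition chart_at p : chart R 4 (orbits R) :=
  Chart (prj_open (@chart_box_open p)) (@sheet_imgo p) (@sheet_cont p)
    (fun y _ => @prj_cont R y) (@sheetK p).

Lemma sheet_local p x : (prj @` chart_box p) (prj x) -> exists m n k l,
  chart_box p (act m n k l x) /\ \near x, sheet p (prj x) = act m n k l x.
Proof.
move=> [y by_ /esym/prjP[m [n [k [l E]]]]]; rewrite E in by_.
exists m, n, k, l; split=> //.
have : nbhs x (act m n k l @^-1` chart_box p).
  by apply: act_cont; apply: open_nbhs_nbhs; split=> //; exact: chart_box_open.
by apply: filterS => z bz; rewrite -(prj_act m n k l) sheet_prj.
Qed.

Lemma chart_overlap p p' x : overlap (chart_at p) (chart_at p') x ->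
  (prj @` chart_box p') (prj x).
Proof. by move=> [q [/= [y yb <-] qb] <-]; rewrite sheet_prj. Qed.

Lemma transition_local p p' x : overlap (chart_at p) (chart_at p') x ->
  exists m n k l, \near x, transition (chart_at p) (chart_at p') x = act m n k l x.
Proof.
by move=> /chart_overlap/sheet_local[m [n [k [l [_ h]]]]]; exists m, n, k, l.
Qed.

Lemma atlas_coverN (q : orbits R) : exists2 c, range chart_at c & cdom c q.
Proof.
have [x <-] := prj_surj q; exists (chart_at x); first by exists x.
by exists x => //; exact: chart_box_ctr.
Qed.

Lemma atlas_smoothN c c' : range chart_at c -> range chart_at c' ->
  smooth (overlap c c') (transition c c').
Proof.
move=> [p _ <-] [p' _ <-]; apply: fsmooth_smooth; apply: fsmooth_local => x.
move=> /transition_local[m [n [k [l h]]]].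
by exists setT, (act m n k l); split=> //; exact: fsmooth_act.
Qed.

Definition target : closed_manifold R 4 :=
  ClosedManifold (@orbits_hausdorff R) (@orbits_second_countable R)
    (@orbits_compact R) atlas_coverN atlas_smoothN.

Lemma near_eq_Jac a b (f h : 'rV[R]_a -> 'rV[R]_b) (x : 'rV[R]_a) :
  (\near x, f x = h x) -> Jac f x = Jac h x.
Proof.
move=> fh; apply/matrixP => i j; rewrite !mxE /pd.
by rewrite (near_eq_derive (delta_mx 0 i) fh).
Qed.

Lemma target_form_change (kap : R) c c' x : range chart_at c -> range chart_at c' ->
  overlap c c' x ->
  target_form kap x = Jac (transition c c') x *m target_form kap (transition c c' x)
               *m (Jac (transition c c') x)^T.
Proof.
move=> [p _ <-] [p' _ <-] /transition_local[m [n [k [l h]]]].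
by rewrite (near_eq_Jac h) (nbhs_singleton h) Jac_act target_form_act.
Qed.

Lemma target_form_smooth (kap : R) (U : set 'rV[R]_4) : smooth U (target_form kap).
Proof.
apply: fsmooth_smooth => k; apply: frechet_Ck_sub (fsmooth_target_form kap k); exact: subsetT.
Qed.

Definition target_metric (kap : R) (kap0 : 0 < kap) : riem_metric target :=
  @RiemMetric R 4 target (fun _ => target_form kap) (fun c _ => @target_form_smooth kap _)
    (fun c x _ _ => @spd_target_form R kap kap0 x) (@target_form_change kap).

End charts.

(** * Christoffel symbols of the target *)

Section metric_derivatives.
Variable R : realType.

Lemma cosDint (a : R) (k : int) : cos (a + 2 * pi * k%:~R) = cos a.
Proof. by rewrite -!sinDpihalf addrAC sinDint. Qed.

Definition dflat1 (r : R) : R := flat (fun T => T * (T * (1 - 0))) r.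
Definition dflat_cos (r : R) : R :=
  flat (fun T => T * (T * (cos (2 * pi * T) - - (2 * pi) * sin (2 * pi * T)))) r.
Definition dflat_sin (r : R) : R :=
  flat (fun T => T * (T * (sin (2 * pi * T) - 2 * pi * cos (2 * pi * T)))) r.

Lemma is_derive_flat1 (r : R) : is_derive r 1 (@flat1 R) (dflat1 r).
Proof.
by apply: (@is_derive_flat R _ (fun=> 0)); exact: tame_cst.
Qed.

Lemma is_derive_flat_cos (r : R) : is_derive r 1 (@flat_cos R) (dflat_cos r).
Proof.
apply: (@is_derive_flat R _ (fun T => - (2 * pi) * sin (2 * pi * T))) => [|T].
  exact: tame_cos.
by apply: is_derive_eq; rewrite /GRing.scale/=; ring.
Qed.

Lemma is_derive_flat_sin (r : R) : is_derive r 1 (@flat_sin R) (dflat_sin r).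
Proof.
apply: (@is_derive_flat R _ (fun T => 2 * pi * cos (2 * pi * T))) => [|T].
  exact: tame_sin.
by apply: is_derive_eq; rewrite /GRing.scale/=; ring.
Qed.

Definition dsinw (w : R) : R := 2 * pi * cos (2 * pi * w).

Lemma is_derive_sinw (w : R) : is_derive w 1 (@sinw R) (dsinw w).
Proof. by apply: is_derive_eq; rewrite /GRing.scale/= /dsinw; ring. Qed.

Lemma is_derive_comp_sinw (f f1 : R -> R) (w : R) :
  (forall r : R, is_derive r 1 f (f1 r)) ->
  is_derive w 1 (fun w => f (sinw w)) (dsinw w * f1 (sinw w)).
Proof.
by move=> D; rewrite mulrC; apply: is_derive1_comp (D _) (is_derive_sinw w).
Qed.

Definition met_pz (z w : R) : R :=
  - (cos (2 * pi * z) * flat_cos (sinw w) + sin (2 * pi * z) * flat_sin (sinw w)).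

Lemma is_derive_met_pz (z w : R) : is_derive z 1 (fun z => met_p z w) (met_pz z w).
Proof.
have p0 : 2 * pi != 0 :> R by rewrite mulf_neq0// gt_eqF// pi_gt0.
apply: is_derive_eq; rewrite /GRing.scale/= /met_pz.
by move: (2 * pi) p0 => q q0; field.
Qed.

Definition met_pw (z w : R) : R := dsinw w *
  ((4 * sinw w ^+ 3 + 20 * sinw w ^+ 4) * flat1 (sinw w)
   + (1 + sinw w ^+ 4 + 4 * sinw w ^+ 5) * dflat1 (sinw w)
   - (2 * pi)^-1 * (sin (2 * pi * z) * dflat_cos (sinw w)
                    - cos (2 * pi * z) * dflat_sin (sinw w))).

Lemma is_derive_met_pw (z w : R) : is_derive w 1 (fun w => met_p z w) (met_pw z w).
Proof.
have D0 := is_derive_sinw w.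
have D1 := is_derive_comp_sinw w is_derive_flat1.
have D2 := is_derive_comp_sinw w is_derive_flat_cos.
have D3 := is_derive_comp_sinw w is_derive_flat_sin.
apply: is_derive_eq; rewrite /GRing.scale/= /met_pw.
ring.
Qed.

Definition met_ew (w : R) : R := dsinw w * dflat1 (sinw w) / 2.

Lemma is_derive_met_ew (w : R) : is_derive w 1 (@met_e R) (met_ew w).
Proof.
have D1 := is_derive_comp_sinw w is_derive_flat1.
by apply: is_derive_eq; rewrite /GRing.scale/= /met_ew; ring.
Qed.

Lemma met_pzD (z w : R) k l : met_pz (z + k%:~R) (w + l%:~R) = met_pz z w.
Proof. by rewrite /met_pz sinwD !(mulrDr (2 * pi)) sinDint cosDint. Qed.

Lemma met_pwD (z w : R) k l : met_pw (z + k%:~R) (w + l%:~R) = met_pw z w.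
Proof. by rewrite /met_pw /dsinw sinwD !(mulrDr (2 * pi)) !sinDint !cosDint. Qed.

End metric_derivatives.

Section christoffel_fibre.
Variables (R : realType) (kap : R).
Hypothesis kap_gt0 : 0 < kap.

Lemma spd_unit d (A : 'M[R]_d) : spd A -> A \in unitmx.
Proof.
move=> [_ pos]; rewrite -row_free_unit; apply: inj_row_free => v vA.
apply: contraTeq isT => v0; have := pos v v0.
by rewrite vA mul0mx mxE ltxx.
Qed.

(** The directions of z and w are orthogonal to each other and to the fibres. *)
Lemma invmx_target_form_base (x : 'rV[R]_4) a :
  invmx (target_form kap x) a o2 = (if a == o2 then kap else 0) /\
  invmx (target_form kap x) a o3 = (if a == o3 then (met_h kap (x 0 o3))^-1 else 0).
Proof.
have U := spd_unit (spd_target_form kap_gt0 x).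
have col (l : 'I_4) h : h != 0 ->
    target_form kap x *m delta_mx l (0:'I_1) = h *: delta_mx l 0 ->
    invmx (target_form kap x) a l = if a == l then h^-1 else 0.
  move=> h0 /(congr1 (mulmx (invmx (target_form kap x)))).
  rewrite mulKmx// -scalemxAr => E.
  have /matrixP/(_ a 0) := congr1 (GRing.scale h^-1) E.
  rewrite scalerA mulVf// scale1r -colE !mxE eqxx andbT => <-.
  by case: eqP => _; rewrite ?mulr1 ?mulr0.
split.
  rewrite (col o2 kap^-1) ?invrK//; first by rewrite invr_eq0 gt_eqF.
  by apply/colP; apply: ord4P; rewrite !mxE sum4 !mxE/=; ring.
rewrite (col o3 (met_h kap (x 0 o3)))//; first by rewrite gt_eqF// met_h_gt0.
by apply/colP; apply: ord4P; rewrite !mxE sum4 !mxE/=; ring.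
Qed.

Definition dz_form (x : 'rV[R]_4) (b c : 'I_4) : R :=
  let z := x 0 o2 in let w := x 0 o3 in
  match (b : nat), (c : nat) with
  | 0, 0 => met_pz z w
  | 0, 1 | 1, 0 => met_pz z w * z + met_p z w
  | 1, 1 => met_pz z w * (z ^+ 2 + 1) + 2 * z * met_p z w + 2 * met_e w
  | _, _ => 0
  end.

Definition dw_form (x : 'rV[R]_4) (b c : 'I_4) : R :=
  let z := x 0 o2 in let w := x 0 o3 in
  match (b : nat), (c : nat) with
  | 0, 0 => met_pw z w
  | 0, 1 | 1, 0 => met_pw z w * z + met_ew w
  | 1, 1 => met_pw z w * (z ^+ 2 + 1) + 2 * z * met_ew w
  | _, _ => 0
  end.

Lemma pd_target_form_fibre (x : 'rV[R]_4) (i b c : 'I_4) : (i < 2)%N ->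
  pd i (fun y => target_form kap y b c) x = 0.
Proof.
move=> i2; rewrite pdE.
have -> : (fun s => target_form kap (pd_line x i s) b c) = fun=> target_form kap x b c.
  apply/funext => s; rewrite /target_form !mxE.
  by have [-> ->] : (o2 == i = false) /\ (o3 == i = false);
    first by split; apply/eqP => E; move: i2; rewrite -E.
exact: derive_cst.
Qed.

Lemma pd_target_form_z (x : 'rV[R]_4) (b c : 'I_4) : (b < 2)%N -> (c < 2)%N ->
  pd o2 (fun y => target_form kap y b c) x = dz_form x b c.
Proof.
move=> b2 c2; rewrite pdE.
pose F (s : R) : R := match (b : nat), (c : nat) with
  | 0, 0 => met_p s (x 0 o3)
  | 0, 1 | 1, 0 => met_p s (x 0 o3) * s + met_e (x 0 o3)
  | 1, 1 => met_p s (x 0 o3) * (s ^+ 2 + 1) + 2 * s * met_e (x 0 o3)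
  | _, _ => 0
  end.
have D := is_derive_met_pz (x 0 o2) (x 0 o3).
have -> : (fun s => target_form kap (pd_line x o2 s) b c) = F.
  apply/funext => s; rewrite /target_form !mxE/= /F; move: b c b2 c2 {F}.
  by apply: ord4P => // + _; apply: ord4P.
rewrite /F /dz_form; move: b c b2 c2 {F}; apply: ord4P => // + _; apply: ord4P => // _;
  apply: derive_val; apply: is_derive_eq; rewrite /GRing.scale/=; ring.
Qed.

Lemma pd_target_form_w (x : 'rV[R]_4) (b c : 'I_4) : (b < 2)%N -> (c < 2)%N ->
  pd o3 (fun y => target_form kap y b c) x = dw_form x b c.
Proof.
move=> b2 c2; rewrite pdE.
pose F (s : R) : R := match (b : nat), (c : nat) with
  | 0, 0 => met_p (x 0 o2) s
  | 0, 1 | 1, 0 => met_p (x 0 o2) s * x 0 o2 + met_e s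
  | 1, 1 => met_p (x 0 o2) s * (x 0 o2 ^+ 2 + 1) + 2 * x 0 o2 * met_e s
  | _, _ => 0
  end.
have D := is_derive_met_pw (x 0 o2) (x 0 o3).
have D' := is_derive_met_ew (x 0 o3).
have -> : (fun s => target_form kap (pd_line x o3 s) b c) = F.
  apply/funext => s; rewrite /target_form !mxE/= /F; move: b c b2 c2 {F}.
  by apply: ord4P => // + _; apply: ord4P.
rewrite /F /dw_form; move: b c b2 c2 {F}; apply: ord4P => // + _; apply: ord4P => // _;
  apply: derive_val; apply: is_derive_eq; rewrite /GRing.scale/=; ring.
Qed.

(** The coefficients depend on z and w only, so for fibre directions b and c the
   only surviving term is the derivative of G_bc in the direction a of the base. *)
Lemma christoffel_fibre (x : 'rV[R]_4) (a b c : 'I_4) : (b < 2)%N -> (c < 2)%N ->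
  christoffel (target_form kap) a b c x =
  - 2^-1 * ((if a == o2 then kap else 0) * dz_form x b c
     + (if a == o3 then (met_h kap (x 0 o3))^-1 else 0) * dw_form x b c).
Proof.
move=> b2 c2; rewrite /christoffel sum4.
rewrite !(pd_target_form_fibre _ _ _ b2) !(pd_target_form_fibre _ _ _ c2).
rewrite !(@pd_target_form_fibre _ o0)// !(@pd_target_form_fibre _ o1)//.
rewrite pd_target_form_z// pd_target_form_w//.
by have [-> ->] := invmx_target_form_base x a; ring.
Qed.

End christoffel_fibre.

(** * Affine maps into the target *)

Section affine_maps.
Variable R : realType.

Lemma det_mx22 (A : 'M[R]_2) : \det A = A 0 0 * A 1 1 - A 0 1 * A 1 0.
Proof.
rewrite (expand_det_row A 0) sum2 /cofactor !det_mx11 !mxE/= expr0 expr1.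
have -> : lift (0 : 'I_2) (0 : 'I_1) = 1 by exact: val_inj.
have -> : lift (1 : 'I_2) (0 : 'I_1) = 0 by exact: val_inj.
by ring.
Qed.

Definition shear_mx (a : R) : 'M[R]_2 :=
  \matrix_(i, j) match (i : nat), (j : nat) with
  | 0, 0 | 1, 1 => 1 | 1, 0 => a | _, _ => 0 end.

(** The flat metric g_a = dx^2 + 2 a dx dy + (a^2 + 1) dy^2. *)
Definition torus_form (a : R) : 'M[R]_2 := shear_mx a *m (shear_mx a)^T.

Definition torus_form_inv (a : R) : 'M[R]_2 :=
  \matrix_(i, j) match (i : nat), (j : nat) with
  | 0, 0 => a ^+ 2 + 1 | 1, 1 => 1 | _, _ => - a end.

Lemma shear_mxV (a : R) : shear_mx a *m shear_mx (- a) = 1%:M.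
Proof.
by apply/matrixP; apply: ord2P; apply: ord2P; rewrite !mxE sum2 !mxE/=; ring.
Qed.

Lemma invmx_shear_mx (a : R) : invmx (shear_mx a) = shear_mx (- a).
Proof.
have [U _] := mulmx1_unit (shear_mxV a).
by rewrite -[RHS](mulKmx U) shear_mxV mulmx1.
Qed.

Lemma torus_formE (a : R) : [/\ torus_form a 0 0 = 1, torus_form a 0 1 = a,
  torus_form a 1 0 = a & torus_form a 1 1 = a ^+ 2 + 1].
Proof. by split; rewrite !mxE sum2 !mxE/=; ring. Qed.

Lemma det_torus_form (a : R) : \det (torus_form a) = 1.
Proof.
by have [g00 g01 g10 g11] := torus_formE a; rewrite det_mx22 g00 g01 g10 g11; ring.
Qed.

Lemma det_shear_mx (a : R) : \det (shear_mx a) = 1.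
Proof. by rewrite det_mx22 !mxE/=; ring. Qed.

Lemma invmx_torus_form (a : R) : invmx (torus_form a) = torus_form_inv a.
Proof.
have E : torus_form a *m torus_form_inv a = 1%:M.
  apply/matrixP; apply: ord2P; apply: ord2P; have [g00 g01 g10 g11] := torus_formE a;
  by rewrite !mxE sum2 ?g00 ?g01 ?g10 ?g11 !mxE/=; ring.
have [U _] := mulmx1_unit E.
by rewrite -[RHS](mulKmx U) E mulmx1.
Qed.

Lemma torus_form_quad (a : R) (v : 'rV[R]_2) :
  (v *m torus_form a *m v^T) 0 0 = (v 0 0 + a * v 0 1) ^+ 2 + v 0 1 ^+ 2.
Proof.
have [g00 g01 g10 g11] := torus_formE a.
by rewrite !mxE sum2 !mxE !sum2 g00 g01 g10 g11; ring.
Qed.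

Lemma spd_torus_form (a : R) : spd (torus_form a).
Proof.
split; first by rewrite /torus_form trmx_mul trmxK.
move=> v v0; rewrite torus_form_quad lt_def addr_ge0 ?sqr_ge0// andbT.
apply: contra_neq v0 => /eqP; rewrite paddr_eq0 ?sqr_ge0// !sqrf_eq0.
move=> /andP[/eqP A /eqP B]; apply/rowP; apply: ord2P; rewrite mxE//.
by rewrite -A B mulr0 addr0.
Qed.

Lemma pd_cst n (W : normedModType R) (a : W) i (x : 'rV[R]_n) : pd i (fun=> a) x = 0.
Proof. exact: derive_cst. Qed.

Lemma christoffel_cst n (A : 'M[R]_n) k i j x : christoffel (fun=> A) k i j x = 0.
Proof.
by rewrite /christoffel big1 ?mulr0// => l _; rewrite !pd_cst addr0 subr0 mulr0.
Qed.

Lemma riemann_cst n (A : 'M[R]_n) l k i j x : riemann (fun=> A) l k i j x = 0.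
Proof.
rewrite /riemann.
have E a b c : (fun y => christoffel (fun=> A) a b c y) = fun=> 0.
  by apply/funext => y; exact: christoffel_cst.
rewrite !E !pd_cst subr0 add0r big1// => m _.
by rewrite !christoffel_cst !mul0r subr0.
Qed.

Lemma near_eq_tension m d (g : 'rV[R]_m -> 'M[R]_m) (G : 'rV[R]_d -> 'M[R]_d)
    (v w : 'rV[R]_m -> 'rV[R]_d) (p : 'rV[R]_m) :
  (\near p, v p = w p) -> tension g G v p = tension g G w p.
Proof.
move=> vw; apply/rowP => a; rewrite !mxE.
have E j : pd j v p = pd j w p by apply: near_eq_derive.
have E2 i j : pd i (fun q => pd j v q) p = pd i (fun q => pd j w q) p.
  by apply: near_eq_derive; apply: near_eq_derive_near.
apply: eq_bigr => i _; apply: eq_bigr => j _.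
rewrite E2 (nbhs_singleton vw); apply: (congr1 ( *%R _)).
apply: (congr2 +%R).
  by apply: (congr1 (fun t => _ - t)); apply: eq_bigr => k _; rewrite E.
by apply: eq_bigr => b _; apply: eq_bigr => c _; rewrite !E.
Qed.

Lemma tension_affine m d (g : 'M[R]_m) (G : 'rV[R]_d -> 'M[R]_d)
    (w : 'rV[R]_m -> 'rV[R]_d) A b (p : 'rV[R]_m) :
  (forall q, w q = q *m A + b) ->
  tension (fun=> g) G w p = \row_a \sum_i \sum_j invmx g i j *
    \sum_b \sum_c christoffel G a b c (w p) * A i b * A j c.
Proof.
move=> wE; apply/rowP => a; rewrite !mxE.
apply: eq_bigr => i _; apply: eq_bigr => j _; congr (_ * _).
have -> : (fun q => pd j w q) = fun=> row j A.
  by apply/funext => q; exact: pd_affine wE j q.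
rewrite pd_cst mxE big1 ?subr0 ?add0r; last first.
  by move=> k _; rewrite christoffel_cst mul0r.
by apply: eq_bigr => b' _; apply: eq_bigr => c _; rewrite !(pd_affine wE) !mxE.
Qed.

Definition fibre_mx (k : int) : 'M[R]_(2, 4) :=
  \matrix_(i, j) match (i : nat), (j : nat) with
  | 0, 0 | 1, 1 => 1 | 1, 0 => - k%:~R | _, _ => 0 end.

Section into_target.
Variable kap : R.
Hypothesis kap_gt0 : 0 < kap.

(** The last two components are - kappa / 2 and - 1 / (2 h) times the traces of
   the z- and w-derivatives of the fibre form.  With the domain metric g_z, these
   traces are taken in the frame in which the fibre form is (p, e; e, p), and
   equal 2 (p_z + e) and 2 p_w. *)
Lemma tension_target_form (w : 'rV[R]_2 -> 'rV[R]_4) (k l : int) b p (z y : R) :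
  (forall q, w q = q *m fibre_mx k + b) ->
  b 0 o2 = z + k%:~R -> b 0 o3 = y + l%:~R ->
  tension (fun=> torus_form z) (target_form kap) w p =
  row4 0 0 (- kap * (met_pz z y + met_e y)) (- (met_h kap y)^-1 * met_pw z y).
Proof.
move=> wE bz by_; rewrite (tension_affine _ _ _ wE).
have w2 : w p 0 o2 = z + k%:~R by rewrite wE !mxE sum2 !mxE/= bz; ring.
have w3 : w p 0 o3 = y + l%:~R by rewrite wE !mxE sum2 !mxE/= by_; ring.
apply/rowP => a; rewrite mxE.
have A2 i : fibre_mx k i o2 = 0 by rewrite mxE; move: i; apply: ord2P.
have A3 i : fibre_mx k i o3 = 0 by rewrite mxE; move: i; apply: ord2P.
have C (F : 'I_4 -> 'I_4 -> R) i j : \sum_b \sum_c F b c * fibre_mx k i b * fibre_mx k j c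
   = F o0 o0 * fibre_mx k i o0 * fibre_mx k j o0 + F o0 o1 * fibre_mx k i o0 * fibre_mx k j o1
   + F o1 o0 * fibre_mx k i o1 * fibre_mx k j o0 + F o1 o1 * fibre_mx k i o1 * fibre_mx k j o1.
  by rewrite !sum4 !A2 !A3; ring.
rewrite !sum2 !C {A2 A3 C} invmx_torus_form.
rewrite !christoffel_fibre// /dz_form /dw_form w2 w3.
rewrite !met_pzD !met_pwD !met_pD !met_hD !met_eD !mxE/=.
move: (met_pz z y) (met_p z y) (met_e y) (k%:~R : R) (met_pw z y) (met_ew _) (met_h kap y)^-1.
move=> pz P e s pw e' h.
by move: a; apply: ord4P => /=; field.
Qed.

End into_target.
End affine_maps.

(** * The trajectory *)

Section trajectory.
Variables (R : realType) (eta : R).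
Hypothesis eta_gt0 : 0 < eta.

Definition kap : R := eta ^+ 2 / 2.
Definition speed : R := eta ^+ 2 / 4.

(** The times at which z > 2, that is r < 1/2, where met_h is polynomial in r. *)
Definition time_dom : set R := [set t | expR 2 < speed * t + expR 3].

Lemma kap_gt0 : 0 < kap. Proof. by rewrite divr_gt0// exprn_gt0. Qed.
Lemma speed_gt0 : 0 < speed. Proof. by rewrite divr_gt0// exprn_gt0. Qed.

(** The solution of z' = (eta^2 / 4) e^(-z) with z(0) = 3. *)
Definition zt (t : R) : R := ln (speed * t + expR 3).

(** The point of the spiral sin (2 pi w) = 1 / z. *)
Definition wt (t : R) : R := (2 * pi)^-1 * asin (zt t)^-1.

Lemma time_dom_open : open time_dom.
Proof.
rewrite (_ : time_dom = (fun t => speed * t + expR 3) @^-1` [set s | expR 2 < s])//.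
apply: open_comp; last exact: open_gt.
move=> t _; apply: continuousD; last exact: cst_continuous.
by apply: continuousM; [exact: cst_continuous|exact: cvg_id].
Qed.

Lemma time_domE t : time_dom t = (- ((expR 3 - expR 2) / speed) < t).
Proof.
rewrite /time_dom/= ltrNl ltr_pdivlMr ?speed_gt0//.
apply/propext; split; lra.
Qed.

Lemma time_dom_ge0 t : 0 <= t -> time_dom t.
Proof.
move=> t0; rewrite /time_dom/=; have := speed_gt0.
have : expR 2 < expR 3 :> R by rewrite ltr_expR; lra.
nra.
Qed.

Lemma zt_gt2 t : time_dom t -> 2 < zt t.
Proof.
move=> h; rewrite /zt -[ltLHS]expRK ltr_ln ?posrE ?expR_gt0//.
exact: lt_trans (expR_gt0 _) h.
Qed.

Lemma zt_inv t : time_dom t -> 0 < (zt t)^-1 < 2^-1.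
Proof.
move=> /zt_gt2 h; have h0 : 0 < zt t by apply: lt_trans h.
by rewrite invr_gt0 h0 ltf_pV2 ?posrE.
Qed.

Lemma zt_inv1 t : time_dom t -> -1 < (zt t)^-1 < 1.
Proof. by move=> /zt_inv/andP[? ?]; apply/andP; split; lra. Qed.

Lemma expR_zt t : time_dom t -> expR (- zt t) = (speed * t + expR 3)^-1.
Proof. by move=> h; rewrite expRN lnK// posrE; exact: lt_trans (expR_gt0 _) h. Qed.

Lemma is_derive_zt t : time_dom t -> is_derive t 1 zt (speed * expR (- zt t)).
Proof.
move=> h; rewrite expR_zt//.
have h0 : 0 < speed * t + expR 3 by exact: lt_trans (expR_gt0 _) h.
have D : is_derive t 1 (fun t : R => speed * t + expR 3) speed.
  by apply: is_derive_eq; rewrite /GRing.scale/=; ring.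
have H := @is_derive1_comp R (@ln R) (fun t => speed * t + expR 3) t _ _
  (is_derive1_ln h0) D.
by apply: is_derive_eq H _; rewrite mulrC.
Qed.

Lemma sinw_wt t : time_dom t -> sinw (wt t) = (zt t)^-1.
Proof.
move=> h; rewrite /sinw /wt mulrA mulfV ?mul1r; last first.
  by rewrite mulf_neq0// gt_eqF// pi_gt0.
by rewrite asinK// in_itv/=; have /andP[? ?] := zt_inv1 h; apply/andP; split; exact: ltW.
Qed.

Lemma dsinw_wt_gt0 t : time_dom t -> 0 < dsinw (wt t).
Proof.
move=> h; rewrite /dsinw /wt mulrA mulfV ?mul1r; last first.
  by rewrite mulf_neq0// gt_eqF// pi_gt0.
by rewrite !mulr_gt0 ?pi_gt0// cos_asin_gt0// zt_inv1.
Qed.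

Lemma dsinw_sqr (w : R) : dsinw w ^+ 2 = 4 * pi ^+ 2 * (1 - sinw w ^+ 2).
Proof. by rewrite /dsinw /sinw exprMn cos2sin2; ring. Qed.

Lemma is_derive_wt t : time_dom t ->
  is_derive t 1 wt (- (speed * expR (- zt t) * (zt t)^-1 ^+ 2) / dsinw (wt t)).
Proof.
move=> h; have D := is_derive_zt h.
have h2 := zt_gt2 h.
have T0 : zt t != 0 by rewrite gt_eqF// (lt_trans _ h2).
have p0 : 2 * pi != 0 :> R by rewrite mulf_neq0// gt_eqF// pi_gt0.
have E : Num.sqrt (1 - (zt t)^-1 ^+ 2) = cos (asin (zt t)^-1).
  by rewrite cos_asin//; have /andP[? ?] := zt_inv1 h; apply/andP; split; exact: ltW.
have c0 : cos (asin (zt t)^-1) != 0 by rewrite gt_eqF// cos_asin_gt0// zt_inv1.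
have Di : is_derive t 1 (fun t => (zt t)^-1) (- (speed * expR (- zt t) * (zt t)^-1 ^+ 2)).
  by apply: is_derive_eq; rewrite /GRing.scale/= -exprVn; ring.
have Da := @is_derive1_comp R (@asin R) (fun t => (zt t)^-1) t _ _
  (is_derive1_asin (zt_inv1 h)) Di.
rewrite E in Da.
have -> : dsinw (wt t) = 2 * pi * cos (asin (zt t)^-1).
  by rewrite /dsinw /wt mulrA mulfV ?mul1r.
apply: is_derive_eq.
rewrite /GRing.scale/=.
move: (2 * pi) (cos _) p0 c0 => q c q0 c0.
by field; rewrite ?q0 ?c0 ?T0.
Qed.

(** The equation z' = - kappa (p_z + e), as p_z = - e^(-z) and e = e^(-z) / 2 on
   the spiral. *)
Lemma ode_z t : time_dom t ->
  speed * expR (- zt t) = - kap * (met_pz (zt t) (wt t) + met_e (wt t)).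
Proof.
move=> h; rewrite /met_pz flat_cosE flat_sinE /met_e sinw_wt// invrK.
have -> : flat1 (zt t)^-1 = expR (- zt t).
  by rewrite /flat1 flat_gt0 ?invrK ?mulr1//; have /andP[] := zt_inv h.
set c := cos _; set s := sin _; set F := expR _.
have E : c ^+ 2 + s ^+ 2 = 1 by exact: cos2Dsin2.
have -> : c * (F * c) + s * (F * s) = F * (c ^+ 2 + s ^+ 2) by ring.
by rewrite E mulr1 /kap /speed; lra.
Qed.

(** The equation w' = - p_w / h, where the left-hand side is the derivative of wt. *)
Lemma ode_w t : time_dom t ->
  - (speed * expR (- zt t) * (zt t)^-1 ^+ 2) / dsinw (wt t)
  = - (met_h kap (wt t))^-1 * met_pw (zt t) (wt t).
Proof.
move=> h; have /andP[r0 r1] := zt_inv h.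
have rE := sinw_wt h; have w0 := dsinw_wt_gt0 h; have w2 := dsinw_sqr (wt t).
have T0 : zt t != 0 by rewrite gt_eqF// (lt_trans _ (zt_gt2 h)).
rewrite /met_pw /met_h rE /dflat1 /dflat_cos /dflat_sin !(flat_gt0 _ r0) invrK.
set r := (zt t)^-1 in r0 r1 rE *.
have -> : flat1 r = expR (- zt t) by rewrite /flat1 flat_gt0// invrK mulr1.
have -> : flat1 (r ^+ 2 - 4^-1) = 0 by rewrite /flat1 flat_le0//; nra.
rewrite rE in w2; have E := cos2Dsin2 (2 * pi * zt t).
have TE : zt t = r^-1 by rewrite /r invrK.
have p0 : pi != 0 :> R by rewrite gt_eqF// pi_gt0.
have k0 := kap_gt0; have q0 : 0 < 1 + 8 * r + 20 * r ^+ 2 by nra.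
have d0 : 0 < 1 - r ^+ 2 by nra.
move: (expR _) (dsinw _) w0 w2 E => F om w0 w2 E.
set c := cos _ in E *; set s := sin _ in E *.
have -> : (s * (F * (zt t * (zt t * (c - - (2 * pi) * s)))) -
       c * (F * (zt t * (zt t * (s - 2 * pi * c))))) =
       2 * pi * F * zt t ^+ 2 * (c ^+ 2 + s ^+ 2) by ring.
rewrite E TE /speed addr0 subr0 mulr1.
have k2 : eta ^+ 2 = 2 * kap by rewrite /kap; field.
rewrite k2; move: kap k0 => K k0.
move: pi p0 w2 => p p0 w2.
have -> : 8 * p ^+ 2 = 2 * (4 * p ^+ 2) by ring.
(* r_w^2 = 4 pi^2 (1 - r^2) is used backwards, so that r_w cancels. *)
have hq : 4 * p ^+ 2 = om ^+ 2 / (1 - r ^+ 2) by rewrite w2 mulfK ?gt_eqF.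
rewrite hq.
field.
by rewrite p0 !gt_eqF.
Qed.


Lemma fsmooth_zt : fsmooth time_dom zt.
Proof.
apply: (fsmooth_comp time_dom_open (fsmooth_ln R)).
  by move=> t /= h; exact: lt_trans (expR_gt0 _) h.
apply: fsmoothD; [exact: time_dom_open| |].
  apply: fsmoothM; [exact: time_dom_open|exact: fsmooth_cst|].
  exact: fsmooth_id time_dom_open.
exact: fsmooth_cst.
Qed.

Lemma fsmooth_wt : fsmooth time_dom wt.
Proof.
apply: fsmoothM; [exact: time_dom_open|exact: fsmooth_cst|].
apply: (fsmooth_comp time_dom_open (fsmooth_asin R)).
  by move=> t; exact: zt_inv1.
apply: (fsmooth_comp time_dom_open (fsmooth_inv R)).
  by move=> t h /=; exact: lt_trans (zt_gt2 h).
exact: fsmooth_zt.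
Qed.

End trajectory.

(** * The solution of the flow *)

Section flat_metrics.
Variable R : realType.

Lemma torus_int_cst (c : R) : torus_int (fun=> c) = c.
Proof.
have I (r : R) : (\int[lebesgue_measure]_(x in `[0%R, 1%R]) r)%R = r.
  rewrite Rintegral_cst//= lebesgue_measure_itv/=.
  by rewrite lte_fin ltr01/= oppr0 addr0 mulr1.
by rewrite /torus_int !I.
Qed.

Definition flat_of (a : R) : flat_metric R.
Proof.
refine (@FlatMetric R (fun=> torus_form a) _ _ _ _ _).
- by move=> k p _.
- by apply: fsmooth_smooth; exact: fsmooth_cst.
- by move=> p; exact: spd_torus_form.
- by move=> l k i j p; exact: riemann_cst.
- by rewrite -[RHS]torus_int_cst; congr torus_int; apply/funext => p;
    rewrite det_torus_form sqrtr1.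
Defined.

End flat_metrics.

Section flow_fields.
Variables (R : realType) (eta : R).
Hypothesis eta_gt0 : 0 < eta.

Let kap := kap eta.
Let kap_gt0 : 0 < kap := kap_gt0 eta_gt0.

Definition lifted_u (t : R) (p : 'rV[R]_2) : 'rV[R]_4 :=
  row4 (p 0 0) (p 0 1) (zt eta t) (wt eta t).

Definition flow_u (t : R) (p : 'rV[R]_2) : target R := prj (lifted_u t p).

Definition flow_g (t : R) : flat_metric R := flat_of (zt eta t).

Lemma act_lifted_u m n k l t p :
  act m n k l (lifted_u t p) =
  p *m fibre_mx R k + row4 m%:~R n%:~R (zt eta t + k%:~R) (wt eta t + l%:~R).
Proof.
by apply/rowP; apply: ord4P; rewrite !mxE/= !sum2 !mxE/=; ring.
Qed.

Definition space_time : set (R * 'rV[R]_2)%type := [set tp | time_dom eta tp.1].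

Lemma space_time_open : open space_time.
Proof.
apply: open_comp; last exact: time_dom_open.
by move=> x _; exact: cvg_fst.
Qed.

Lemma fsmooth_st_t (f : R -> R) : fsmooth (time_dom eta) f ->
  fsmooth space_time (fun tp => f tp.1).
Proof.
move=> F; apply: (fsmooth_comp space_time_open F) => //.
exact: fsmooth_fst space_time_open.
Qed.

Lemma fsmooth_lifted : fsmooth space_time (fun tp => lifted_u tp.1 tp.2).
Proof.
have oS := space_time_open.
have P i : fsmooth space_time (fun tp : R * 'rV[R]_2 => tp.2 0 i).
  by apply: fsmooth_coord => //; exact: fsmooth_snd.
have Z := fsmooth_st_t (@fsmooth_zt R eta).
have W := fsmooth_st_t (@fsmooth_wt R eta).
apply: (fsmooth_mx oS) => i j; rewrite (ord1 i).
move: j; apply: ord4P.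
- by apply: (fsmooth_eq oS _ (P 0)) => x _; rewrite mxE.
- by apply: (fsmooth_eq oS _ (P 1)) => x _; rewrite mxE.
- by apply: (fsmooth_eq oS _ Z) => x _; rewrite mxE.
- by apply: (fsmooth_eq oS _ W) => x _; rewrite mxE.
Qed.

Lemma fsmooth_act_lifted m n k l :
  fsmooth space_time (fun tp => act m n k l (lifted_u tp.1 tp.2)).
Proof.
have oS := space_time_open; have L := fsmooth_lifted.
have C i := fsmooth_coord 0 i oS L.
apply: (fsmooth_mx oS) => i j; rewrite (ord1 i).
apply: (fsmooth_eq oS (h := fun tp => \sum_i lifted_u tp.1 tp.2 0 i * deck_mx R k i j
   + deck_shift R m n k l 0 j)).
  by move=> x _; rewrite actE !mxE.
apply: fsmoothD => //; last exact: fsmooth_cst.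
by apply: fsmooth_sum => // a; apply: fsmoothM => //; exact: fsmooth_cst.
Qed.

Lemma lifted_u_cont t p : time_dom eta t ->
  {for (t, p), continuous (fun tp => lifted_u tp.1 tp.2)}.
Proof. by move=> h; apply: (fsmooth_cont fsmooth_lifted). Qed.

Lemma cmap_flow_local c t p : time_dom eta t -> range (@chart_at R) c ->
  cdom c (flow_u t p) -> exists m n k l,
  \forall tp \near (t, p), cmap c (flow_u tp.1 tp.2) = act m n k l (lifted_u tp.1 tp.2).
Proof.
move=> h [q _ <-] /sheet_local[m [n [k [l [_ H]]]]]; exists m, n, k, l.
have := @lifted_u_cont t p h _ H; exact.
Qed.

Lemma flow_u_smooth : smooth_map space_time (fun tp => flow_u tp.1 tp.2).
Proof.
split.
  move=> [t p] h; apply: (@continuous_comp _ _ _ (fun tp => lifted_u tp.1 tp.2) prj).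
    exact: lifted_u_cont.
  exact: prj_cont.
move=> c cA; apply: fsmooth_smooth; apply: fsmooth_local => -[t p] [h /= dc].
have [m [n [k [l H]]]] := cmap_flow_local h cA dc.
exists space_time, (fun tp => act m n k l (lifted_u tp.1 tp.2)); split=> //.
exact: fsmooth_act_lifted.
Qed.

Lemma flow_g_smooth : smooth space_time (fun tp => flow_g tp.1 tp.2).
Proof.
have oS := space_time_open; apply: fsmooth_smooth.
have Z := fsmooth_st_t (@fsmooth_zt R eta).
have C (a : R) : fsmooth space_time (fun=> a) by exact: fsmooth_cst.
have g tp i j : flow_g tp.1 tp.2 i j = torus_form (zt eta tp.1) i j by [].
apply: (fsmooth_mx oS); apply: ord2P; apply: ord2P.
- by apply: (fsmooth_eq oS _ (C 1)) => x _; have [] := torus_formE (zt eta x.1).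
- by apply: (fsmooth_eq oS _ Z) => x _; have [] := torus_formE (zt eta x.1).
- by apply: (fsmooth_eq oS _ Z) => x _; have [] := torus_formE (zt eta x.1).
- apply: (fsmooth_eq oS (h := fun x => zt eta x.1 ^+ 2 + 1)).
    by move=> x _; have [] := torus_formE (zt eta x.1).
  by apply: fsmoothD => //; exact: fsmoothX.
Qed.

Lemma near_pair_l (t : R) (p : 'rV[R]_2) (P : R * 'rV[R]_2 -> Prop) :
  (\forall x \near (t, p), P x) -> \forall s \near t, P (s, p).
Proof.
move=> [[A B] /= [nA nB] H]; apply: filterS nA => s As; apply: H; split=> //=.
exact: nbhs_singleton.
Qed.

Lemma near_pair_r (t : R) (p : 'rV[R]_2) (P : R * 'rV[R]_2 -> Prop) :
  (\forall x \near (t, p), P x) -> \forall q \near p, P (t, q).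
Proof.
move=> [[A B] /= [nA nB] H]; apply: filterS nB => s Bs; apply: H; split=> //=.
exact: nbhs_singleton.
Qed.

Lemma derive_row4 (a b c d : R -> R) (t a' b' c' d' : R) :
  is_derive t 1 a a' -> is_derive t 1 b b' -> is_derive t 1 c c' ->
  is_derive t 1 d d' ->
  'D_1 (fun s => row4 (a s) (b s) (c s) (d s)) t = row4 a' b' c' d'.
Proof.
move=> Da Db Dc Dd.
have D j : is_derive t 1 (fun s => row4 (a s) (b s) (c s) (d s) 0 j)
    (row4 a' b' c' d' 0 j).
  rewrite mxE (_ : (fun s => _) = fun s => match (j : nat) with
    | 0 => a s | 1 => b s | 2 => c s | _ => d s end).
    by move: j; apply: ord4P.
  by apply/funext => s; rewrite mxE.
rewrite derive_mx.
  by apply/matrixP => i j; rewrite (ord1 i) mxE; apply: derive_val.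
by apply/derivable_mxP => i j; rewrite (ord1 i); apply: ex_derive.
Qed.

Lemma flow_mapP t (p : 'rV[R]_2) c :
  0 <= t -> @atlas R 4 (target R) c -> cdom c (flow_u t p) ->
  derive1 (fun s => cmap c (flow_u s p)) t =
  tension (flow_g t) (rm (target_metric kap_gt0) c) (cmap c \o flow_u t) p.
Proof.
move=> t0 cA dc; have h := time_dom_ge0 eta_gt0 t0.
have [m [n [k [l H]]]] := cmap_flow_local h cA dc.
rewrite (near_eq_tension _ _ (near_pair_r H)).
rewrite (tension_target_form kap_gt0 p (fun q => act_lifted_u m n k l t q)
  (z := zt eta t) (y := wt eta t) (l := l)); try by rewrite mxE.
rewrite derive1E (near_eq_derive _ (near_pair_l H)).
have -> : (fun s => act m n k l (lifted_u s p)) = (fun s =>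
    row4 (p 0 0 - k%:~R * p 0 1 + m%:~R) (p 0 1 + n%:~R)
      (zt eta s + k%:~R) (wt eta s + l%:~R)).
  by apply/funext => s; apply/rowP; apply: ord4P; rewrite !mxE.
have DT := is_derive_zt h; have dw_form := is_derive_wt h.
apply: derive_row4.
- by rewrite /kap -(ode_z h); apply: is_derive_eq; rewrite addr0.
- by rewrite /kap -(ode_w eta_gt0 h); apply: is_derive_eq; rewrite addr0.
Qed.

End flow_fields.

Section hopf.
Variable R : realType.

Definition iso_coord (a : R) (p : 'rV[R]_2) : 'rV[R]_2 := p *m shear_mx a.

Lemma iso_coordE a p : iso_coord a p = p *m shear_mx a + 0.
Proof. by rewrite addr0. Qed.

Lemma Jac_iso_coord a p : Jac (iso_coord a) p = shear_mx a.
Proof. exact: Jac_affine (iso_coordE a) p. Qed.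

(** These coordinates are isothermal because g_a = J J^T for the shear J. *)
Lemma isothermal_iso_coord a : isothermal (flat_of a) setT (iso_coord a).
Proof.
split.
- exact: openT.
- by apply: fsmooth_smooth; exact: fsmooth_affine (iso_coordE a).
- move=> p q _ _ /(congr1 (mulmx^~ (shear_mx (- a)))).
  by rewrite /iso_coord -!mulmxA shear_mxV !mulmx1.
- by move=> p _; rewrite Jac_iso_coord det_shear_mx.
- by move=> p _; exists 1 => //; rewrite Jac_iso_coord scale1r.
Qed.

Lemma near_eq_hopf d (G : 'rV[R]_d -> 'M[R]_d) z (v w : 'rV[R]_2 -> 'rV[R]_d)
    (p : 'rV[R]_2) :
  (\near p, v p = w p) -> hopf_coef G z v p = hopf_coef G z w p.
Proof.
by move=> vw; rewrite /hopf_coef /coord_deriv (near_eq_Jac vw) (nbhs_singleton vw).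
Qed.

(** In isothermal coordinates of g_z the fibre form has the matrix (p, e; e, p),
   so the Hopf differential is - 2 i e dz^2. *)
Lemma hopf_target_form (kap : R) (w : 'rV[R]_2 -> 'rV[R]_4) (k l : int) b p (z y : R) :
  (forall q, w q = q *m fibre_mx R k + b) ->
  b 0 o2 = z + k%:~R -> b 0 o3 = y + l%:~R ->
  hopf_coef (target_form kap) (iso_coord z) w p = (0 -i* (2 * met_e y))%C.
Proof.
move=> wE bz by_; rewrite /hopf_coef /coord_deriv Jac_iso_coord (Jac_affine wE) invmx_shear_mx.
have w2 : w p 0 o2 = z + k%:~R by rewrite wE !mxE sum2 !mxE/= bz; ring.
have w3 : w p 0 o3 = y + l%:~R by rewrite wE !mxE sum2 !mxE/= by_; ring.
rewrite /target_form w2 w3 met_pD met_eD.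
have -> : shear_mx (- z) *m fibre_mx R k = \matrix_(i, j) match (i : nat), (j : nat) with
  | 0, 0 | 1, 1 => 1 | 1, 0 => - (z + k%:~R) | _, _ => 0 end.
  by apply/matrixP; apply: ord2P; apply: ord4P; rewrite !mxE sum2 !mxE/=; ring.
move: (met_p z y) (met_e y) (met_h _ _) kap^-1 (z + _) => P E H K s.
by congr (_ -i* _)%C; rewrite !mxE !sum4 !mxE !sum4 !mxE/=; ring.
Qed.

(** The Hopf differential of the solution (hopf_target_form).  Its coefficient is
   constant, so it is holomorphic and equal to its projection. *)
Definition flow_psi (a e : R) : qfield R := fun p =>
  ((0 -i* (2 * e))%C : cfield R) *: dz2 (iso_coord a) p.

Lemma flow_psi_hol a e : holomorphic_qd (flat_of a) (flow_psi a e).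
Proof.
split; first by move=> k p _; rewrite /flow_psi /dz2 /dz !Jac_iso_coord.
move=> p0; exists setT, (iso_coord a), (fun=> (0 -i* (2 * e))%C : cfield R); split => //.
exact: isothermal_iso_coord.
Qed.

Lemma qd_inner0 g (Theta : qfield R) : qd_inner g (fun=> 0) Theta = 0.
Proof.
have E p : qd_density g (fun=> 0) Theta p = 0.
  rewrite /qd_density big1 ?mulr0// => i _; rewrite big1// => j _.
  by rewrite big1// => k _; rewrite big1// => l _; rewrite mxE mulr0 mul0r.
rewrite /qd_inner.
have -> : (fun p => complex.Re (qd_density g (fun=> 0) Theta p)) = fun=> 0.
  by apply/funext => p; rewrite E.
have -> : (fun p => complex.Im (qd_density g (fun=> 0) Theta p)) = fun=> 0.
  by apply/funext => p; rewrite E.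
by rewrite torus_int_cst.
Qed.

Lemma flow_psi_proj a e : is_hol_projection (flat_of a) (flow_psi a e) (flow_psi a e).
Proof.
split; first exact: flow_psi_hol.
move=> Theta _; rewrite (_ : (fun p => _ - _) = fun=> 0) ?qd_inner0//.
by apply/funext => p; rewrite subrr.
Qed.

Lemma Re_flow_psi a e p : map_mx (@complex.Re R) (flow_psi a e p) =
  \matrix_(i, j) match (i : nat), (j : nat) with
  | 0, 0 => 0 | 1, 1 => 4 * e * a | _, _ => 2 * e end.
Proof.
rewrite /flow_psi /dz2 /dz Jac_iso_coord.
apply/matrixP; apply: ord2P; apply: ord2P;
  rewrite !mxE big_ord1 !mxE/=; ring.
Qed.

End hopf.

Section flow_equations.
Variables (R : realType) (eta : R).
Hypothesis eta_gt0 : 0 < eta.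

Lemma flow_metricP t p : 0 <= t ->
  derive1 (fun s => flow_g eta s p) t =
  (eta ^+ 2 / 4) *: map_mx (@complex.Re R) (flow_psi (zt eta t) (met_e (wt eta t)) p).
Proof.
move=> t0; have h := time_dom_ge0 eta_gt0 t0; rewrite derive1E Re_flow_psi.
have DT := is_derive_zt h.
have eE : 2 * met_e (wt eta t) = expR (- zt eta t).
  rewrite /met_e sinw_wt// /flat1 flat_gt0 ?invrK; last by have /andP[] := zt_inv h.
  by rewrite mulr1 mulrC divfK.
have D i j : is_derive t 1 (fun s => torus_form (zt eta s) i j) (((eta ^+ 2 / 4) *:
   (\matrix_(i, j) match (i : nat), (j : nat) with
  | 0, 0 => 0 | 1, 1 => 4 * met_e (wt eta t) * zt eta t
  | _, _ => 2 * met_e (wt eta t) end : 'M[R]_2)) i j).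
  rewrite !mxE; move: i j; apply: ord2P; apply: ord2P => /=.
  - rewrite (_ : (fun s => _) = fun=> 1); first by rewrite mulr0; exact: is_derive_cst.
    by apply/funext => s; have [] := torus_formE (zt eta s).
  - rewrite (_ : (fun s => _) = zt eta); first by rewrite eE.
    by apply/funext => s; have [] := torus_formE (zt eta s).
  - rewrite (_ : (fun s => _) = zt eta); first by rewrite eE.
    by apply/funext => s; have [] := torus_formE (zt eta s).
  - rewrite (_ : (fun s => _) = fun s => zt eta s ^+ 2 + 1); last first.
      by apply/funext => s; have [] := torus_formE (zt eta s).
    rewrite (_ : 4 * _ = 2 * expR (- zt eta t)); last by rewrite -eE; ring.
    by apply: is_derive_eq; rewrite /GRing.scale/= /speed; ring.
rewrite derive_mx.
  by apply/matrixP => i j; rewrite mxE; apply: derive_val.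
by apply/derivable_mxP => i j; apply: ex_derive.
Qed.

Lemma flow_solution : thm_flow eta (target_metric (kap_gt0 eta_gt0)) (flow_u eta) (flow_g eta).
Proof.
split.
- move=> t k p /[dup] lk.
  move=> /(_ 0)/intrP[a ka]; have /intrP[b kb] := lk 1.
  rewrite /flow_u -(prj_act a b 0 0 (lifted_u eta t p)); congr prj.
  by apply/rowP; apply: ord4P; rewrite !mxE/= ?ka ?kb ?mul0r ?subr0 ?addr0.
- exists ((expR 3 - expR 2) / speed eta).
    by rewrite divr_gt0 ?speed_gt0// subr_gt0 ltr_expR; lra.
  have -> : [set tp : R * 'rV[R]_2 | - ((expR 3 - expR 2) / speed eta) < tp.1]
     = space_time eta.
    by apply/seteqP; split=> -[t p] /=; rewrite /space_time/= time_domE.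
  by split; [exact: flow_u_smooth|exact: flow_g_smooth].
- by move=> t p c; exact: flow_mapP.
- move=> t t0; have h := time_dom_ge0 eta_gt0 t0.
  pose P := flow_psi (zt eta t) (met_e (wt eta t)); exists P, P; split.
  + move=> p0; exists setT, (iso_coord (zt eta t)); split=> //.
      exact: isothermal_iso_coord.
    move=> p c _ cA dc; rewrite /P /flow_psi; congr (_ *: _).
    have [m [n [k [l H]]]] := cmap_flow_local h cA dc.
    rewrite (near_eq_hopf _ _ (near_pair_r H)).
    by rewrite (hopf_target_form _ _ (fun q => act_lifted_u eta m n k l t q)
      (y := wt eta t) (l := l)) ?mxE.
  + exact: flow_psi_proj.
  + by move=> p; exact: flow_metricP.
Qed.

End flow_equations.

(** * Injectivity radius and moduli space *)

Section injectivity.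
Variables (R : realType) (a : R).

Lemma derive1_line n (p v : 'rV[R]_n) : derive1 (fun s => p + s *: v) = fun=> v.
Proof.
apply/funext => s; rewrite derive1E.
have E : (fun h => h^-1 *: ((p + (h *: 1 + s) *: v) - (p + s *: v)))
    @ (0 : R)^' --> v.
  apply: cvg_near_cst; near=> h.
  have h0 : h != 0 by near: h; exact: nbhs_dnbhs_neq.
  rewrite opprD addrACA subrr add0r -scalerBl addrK /GRing.scale/= mulr1.
  by rewrite -/(GRing.scale _ _) scalerA mulVf// scale1r.
exact: cvg_lim E.
Unshelve. all: by end_near. Qed.

Lemma geodesic_line (p v : 'rV[R]_2) : is_geodesic (flat_of a) (fun s => p + s *: v).
Proof.
split.
  apply: fsmooth_smooth; apply: (fsmoothD openT); first exact: fsmooth_cst.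
  by apply: fsmoothZ; [exact: openT|apply: fsmooth_id; exact: openT].
move=> s k; rewrite derive1_line derive1_cst mxE add0r big1// => i _.
by rewrite big1// => j _; rewrite christoffel_cst !mul0r.
Qed.

Lemma tangent_ballE r p v : tangent_ball (flat_of a) p r v =
  ((v 0 0 + a * v 0 1) ^+ 2 + v 0 1 ^+ 2 < r ^+ 2).
Proof. by rewrite /tangent_ball/= torus_form_quad. Qed.

Lemma fsmooth_quad : fsmooth setT
  (fun v : 'rV[R]_2 => (v 0 0 + a * v 0 1) ^+ 2 + v 0 1 ^+ 2).
Proof.
have oT := @openT 'rV[R]_2.
have C i : fsmooth [set: 'rV[R]_2] (fun v => v 0 i).
  by apply: fsmooth_coord => //; exact: fsmooth_id.
apply: fsmoothD => //; apply: fsmoothX => //; apply: fsmoothD => //.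
by apply: fsmoothM => //; exact: fsmooth_cst.
Qed.

Lemma tangent_ball_open r p : open (tangent_ball (flat_of a) p r).
Proof.
rewrite (_ : tangent_ball _ _ _ =
  (fun v : 'rV[R]_2 => (v 0 0 + a * v 0 1) ^+ 2 + v 0 1 ^+ 2) @^-1`
    [set s | s < r ^+ 2]); last by apply/funext => v; rewrite tangent_ballE.
apply: open_comp; last exact: open_lt.
by move=> v _; apply: (fsmooth_cont fsmooth_quad).
Qed.

Lemma lattice_quad_small (k : 'rV[R]_2) : lattice k ->
  (k 0 0 + a * k 0 1) ^+ 2 + k 0 1 ^+ 2 < 1 -> k = 0.
Proof.
move=> lk q1; have /intrP[m km] := lk 0; have /intrP[n kn] := lk 1.
have sq (x : R) : x ^+ 2 < 1 -> `|x| < 1.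
  by move=> x1; rewrite ltr_norml; apply/andP; split; nra.
have n0 : n = 0.
  apply: (@int_small R); rewrite -kn; apply: sq.
  by have := sqr_ge0 (k 0 0 + a * k 0 1); lra.
have m0 : m = 0.
  apply: (@int_small R); rewrite -km; apply: sq.
  by move: q1; rewrite kn n0 mulr0 addr0 expr0n/= addr0.
by apply/rowP; apply: ord2P; rewrite mxE ?km ?kn ?m0 ?n0.
Qed.

(** Straight lines are geodesics, so the exponential map is a translation; two
   vectors shorter than 1/2 differ by a vector shorter than 1, which is not a
   nonzero lattice vector. *)
Lemma flat_exp_diffeo p : exp_diffeo (flat_of a) p 2^-1.
Proof.
exists (fun v => p + v); split.
- move=> v; split; first exact: geodesic_line.
  + by rewrite addr0.
  + by rewrite derive1_line.
- split.
  + apply: fsmooth_smooth => k.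
    apply: frechet_Ck_sub (_ : frechet_Ck k setT _); first exact: subsetT.
    by apply: frechet_CkD; [exact: openT|exact: frechet_Ck_cst|apply: fsmooth_id; exact: openT].
  + have -> : (fun v => p + v) @` tangent_ball (flat_of a) p 2^-1 =
       (fun q => q - p) @^-1` tangent_ball (flat_of a) p 2^-1.
      apply/seteqP; split=> [_ [v hv <-]|q hq]; first by rewrite /= addrC addKr.
      by exists (q - p) => //; rewrite addrC subrK.
    apply: open_comp; last exact: tangent_ball_open.
    by move=> q _; apply: continuousB; [exact: cvg_id|exact: cst_continuous].
  + exists (fun q => q - p); split; last by move=> v _; rewrite addrC addKr.
    apply: fsmooth_smooth => k.
    apply: frechet_Ck_sub (_ : frechet_Ck k setT _); first exact: subsetT.
    by apply: frechet_CkD; [exact: openT|apply: fsmooth_id; exact: openT|exact: frechet_Ck_cst].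
- move=> v w; rewrite !tangent_ballE opprD addrACA subrr add0r => hv hw lk.
  apply: subr0_eq; apply: (lattice_quad_small lk); rewrite !mxE.
  have := sqr_ge0 (v 0 0 + a * v 0 1 + (w 0 0 + a * w 0 1)).
  by have := sqr_ge0 (v 0 1 + w 0 1); nra.
Qed.

Lemma flat_inj_radius : ((2^-1)%:E <= inj_radius (flat_of a))%E.
Proof.
apply: le_ereal_inf_tmp => _ [p _ <-]; apply: ereal_sup_ubound.
by exists 2^-1 => //=; split; [rewrite invr_gt0|exact: flat_exp_diffeo].
Qed.

End injectivity.

Section moduli_space.
Variable R : realType.

Lemma ipd_cst (W : normedModType R) (c : W) (i : 'I_2) s :
  ipd (i :: s) (fun=> c) = fun=> 0.
Proof.
elim: s i => [|j s IH] i; first by apply/funext => p; exact: pd_cst.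
by apply/funext => p; rewrite -[LHS]/(pd i (ipd (j :: s) (fun=> c)) p) IH pd_cst.
Qed.

Lemma torus_form_cont : continuous (@torus_form R).
Proof.
have oT := @openT R; have C (x : R) : fsmooth [set: R] (fun=> x) by exact: fsmooth_cst.
have I : fsmooth [set: R] (fun x => x) by exact: fsmooth_id.
have G : fsmooth setT (@torus_form R).
  apply: (fsmooth_mx oT); apply: ord2P; apply: ord2P.
  - by apply: (fsmooth_eq oT _ (C 1)) => x _; have [] := torus_formE x.
  - by apply: (fsmooth_eq oT _ I) => x _; have [] := torus_formE x.
  - by apply: (fsmooth_eq oT _ I) => x _; have [] := torus_formE x.
  - apply: (fsmooth_eq oT (h := fun x => x ^+ 2 + 1)).
      by move=> x _; have [] := torus_formE x.
    by apply: fsmoothD => //; exact: fsmoothX.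
by move=> x; apply: (fsmooth_cont G).
Qed.

Lemma flat_of_cont : continuous (@flat_of R : R -> flat_metric R).
Proof.
move=> a A; rewrite nbhsE => -[B [oB Ba] BA].
have [k [e e0 kB]] : exists k, exists2 e : R, 0 < e & Cinf_close k e (flat_of a) `<=` B.
  exact: oB.
have : \forall b \near a, `|torus_form a - torus_form b| <= e.
  by have /cvgrPdist_le := @torus_form_cont a; apply.
apply: filterS => b ab; apply: BA; apply: kB => -[|i s] p _.
  by rewrite distrC.
rewrite [X in `|X - _|](_ : _ = 0).
rewrite [X in `|_ - X|](_ : _ = 0).
rewrite subr0.
rewrite normr0.
exact: ltW.
exact: (congr1 (fun f => f p) (ipd_cst (torus_form a) i s)).
exact: (congr1 (fun f => f p) (ipd_cst (torus_form b) i s)).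
Qed.

Definition shear (k : int) (p : 'rV[R]_2) : 'rV[R]_2 := p *m shear_mx k%:~R.

Lemma shear_torus k : torus_map (shear k).
Proof.
move=> v p lv; rewrite /shear mulmxDl addrC addKr => j.
rewrite mxE sum2 !mxE; have /intrP[m ->] := lv 0; have /intrP[n ->] := lv 1.
by move: j; apply: ord2P => /=;
  rewrite ?mulr0 ?mulr1 ?add0r -?intrM -?intrD intr_int.
Qed.

Lemma shearK k : cancel (shear k) (shear (- k)).
Proof. by move=> p; rewrite /shear rmorphN -mulmxA shear_mxV mulmx1. Qed.

Lemma shear_diffeo k : torus_diffeo (shear k).
Proof.
have S j : smooth setT (shear j).
  apply: fsmooth_smooth; apply: (fsmooth_affine (A := shear_mx j%:~R) (b := 0)) => x.
  by rewrite addr0.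
exists (shear (- k)); split => //; first by split; exact: shear_torus.
  exact: shearK.
by move=> p; rewrite -{1}[k]opprK shearK.
Qed.

Lemma shear_mxD (x y : R) : shear_mx x *m shear_mx y = shear_mx (x + y).
Proof.
by apply/matrixP; apply: ord2P; apply: ord2P; rewrite !mxE sum2 !mxE/=; ring.
Qed.

(** A Dehn twist of T^2 is an isometry from g_(a+k) to g_a. *)
Lemma moduli_shear (a : R) k : moduli_rel (flat_of a) (flat_of (a + k%:~R)).
Proof.
have J p : Jac (shear k) p = shear_mx k%:~R.
  by apply: (Jac_affine (b := 0)) => x; rewrite addr0.
exists (shear k); split; first exact: shear_diffeo.
  by move=> p; rewrite J det_shear_mx.
have E : shear_mx k%:~R *m torus_form a *m (shear_mx k%:~R)^T = torus_form (a + k%:~R).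
  by rewrite /torus_form !mulmxA shear_mxD -mulmxA -trmx_mul shear_mxD addrC.
by move=> p; rewrite /pullback J; exact: esym E.
Qed.

Lemma moduli_class_shear (a : R) k :
  moduli_class (flat_of (a + k%:~R)) = moduli_class (flat_of a).
Proof.
apply/esym/eqmodP/asboolP; apply: Relation_Operators.rst_step.
exact: moduli_shear.
Qed.

Lemma flat_moduli_compact : exists2 K : set (moduli R), compact K &
  forall a, K (moduli_class (flat_of a)).
Proof.
exists ((fun a => moduli_class (flat_of a)) @` `[0, 1]%classic).
  apply: continuous_compact; last exact: segment_compact.
  apply: continuous_subspaceT => a.
  apply: (@continuous_comp _ _ _ (@flat_of R) (@moduli_class R)).
    exact: flat_of_cont.
  exact: pi_continuous.
move=> a; exists (a + (- Num.floor a)%:~R); last exact: moduli_class_shear.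
rewrite /= in_itv/= rmorphN subr_ge0 floor_le/= lerBlDl.
by have := ltW (floorD1_gt a); rewrite rmorphD/=.
Qed.

End moduli_space.

(** * Maps of class C^1 are differentiable *)

Section C1_differentiable.
Variable R : realType.

Lemma is_derive_line (W : normedModType R) (V : normedModType R) (f : V -> W)
    (y v : V) (s : R) : derivable f (y + s *: v) v ->
  is_derive s 1 (fun s => f (y + s *: v)) ('D_v f (y + s *: v)).
Proof.
move=> df.
have E : (fun h => h^-1 *: (f (y + (h *: 1 + s) *: v) - f (y + s *: v))) =
    (fun h => h^-1 *: (f (h *: v + (y + s *: v)) - f (y + s *: v))).
  apply/funext => h; congr (_ *: (f _ - _)).
  by rewrite scalerDl addrCA [h *: 1]mulr1.
apply: DeriveDef; first by rewrite /derivable E.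
by rewrite /derive E.
Qed.

Lemma MVT0 (f df : R -> R) (h : R) :
  (forall x : R, is_derive x 1 f (df x)) ->
  exists2 t, `|t| <= `|h| & f h - f 0 = df t * h.
Proof.
move=> D; have cf : continuous f.
  by move=> x; apply: differentiable_continuous; apply/derivable1_diffP; case: (D x).
have [h0|h0] := leP 0 h.
  have [t] := @MVT_segment _ f df 0 h h0 (fun x _ => D x) (continuous_subspaceT cf).
  rewrite in_itv/= => /andP[t0 th] ->; exists t; last by rewrite subr0.
  by rewrite !ger0_norm.
have [t] := @MVT_segment _ f df h 0 (ltW h0) (fun x _ => D x) (continuous_subspaceT cf).
rewrite in_itv/= => /andP[t0 th] E; exists t.
  by rewrite !ler0_norm ?lerN2// ltW.
by rewrite -opprB E sub0r mulrN opprK.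
Qed.

(** The increment is split into one parallel to each axis, and the mean value
   theorem is applied to both. *)
Lemma C1_differentiable (f : 'rV[R]_2 -> R) (x : 'rV[R]_2) :
  (forall i y, derivable f y (delta_mx 0 i)) ->
  (forall i, {for x, continuous (pd i f)}) -> differentiable f x.
Proof.
move=> df cf.
pose A : 'cV[R]_2 := \col_i pd i f x.
have Ll : linear (fun h : 'rV[R]_2 => (h *m A) 0 0).
  by move=> k u v; rewrite mulmxDl -scalemxAl !mxE.
pose lM := GRing.isLinear.Build _ _ _ _ _ Ll.
pose L : {linear 'rV[R]_2 -> R} := HB.pack (fun h : 'rV[R]_2 => (h *m A) 0 0) lM.
have LE h : L h = h 0 0 * pd 0 f x + h 0 1 * pd 1 f x.
  by rewrite /L/= mxE sum2 !mxE.
have Lc : continuous L.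
  have -> : (L : 'rV[R]_2 -> R) = fun h => h 0 0 * pd 0 f x + h 0 1 * pd 1 f x.
    by apply/funext.
  have oT := @openT 'rV[R]_2.
  have G : fsmooth setT (fun h : 'rV[R]_2 => h 0 0 * pd 0 f x + h 0 1 * pd 1 f x).
    by apply: fsmoothD => //; apply: fsmoothM => //; (exact: fsmooth_cst) ||
      (apply: fsmooth_coord => //; exact: fsmooth_id).
  by move=> h; apply: (fsmooth_cont G).
suff : is_diff x f L by move=> [].
apply: (diff_littleP Lc) => e e0.
have e2 : 0 < e / 2 by rewrite divr_gt0.
have close i : exists2 d : R, 0 < d & forall y : 'rV[R]_2, `|y| < d ->
    `|pd i f (x + y) - pd i f x| <= e / 2.
  have /cvgrPdist_le/(_ _ e2) := cf i.
  move=> /nbhs0P/nbhs_ballP[d d0 H]; exists d => // y yd.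
  rewrite distrC; apply: H; rewrite -ball_normE /= sub0r normrN//.
have [d0 d00 H0] := close 0; have [d1 d10 H1] := close 1.
pose d := Num.min d0 d1; have dp : 0 < d by rewrite lt_min d00.
have := @nbhs0_lt R 'rV[R]_2 d dp; apply: filterS => h hd.
have coordle (y : 'rV[R]_2) i : `|y 0 i| <= `|y|.
  rewrite [leRHS]/Num.Def.normr/= mx_normrE.
  exact: (@le_bigmax _ _ _ 0 (fun ij => `|y ij.1 ij.2|) (0, i)).
pose e_ (i : 'I_2) : 'rV[R]_2 := delta_mx 0 i.
have [s s1 E1] := MVT0 (h 0 0) (fun t => is_derive_line (df 0 (x + t *: e_ 0))).
have [t t1 E2] := MVT0 (h 0 1)
  (fun t => is_derive_line (df 1 (x + h 0 0 *: e_ 0 + t *: e_ 1))).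
rewrite scale0r addr0 in E1; rewrite scale0r addr0 in E2.
have hE : x + h 0 0 *: e_ 0 + h 0 1 *: e_ 1 = h + x.
  by apply/rowP; apply: ord2P; rewrite !mxE/=; ring.
rewrite hE in E2.
have norm_le (y : 'rV[R]_2) : (forall i, `|y 0 i| <= `|h 0 i|) -> `|y| <= `|h|.
  move=> yh; rewrite [leLHS]/Num.Def.normr/= mx_normrE; apply: bigmax_le => //= -[a i] _.
  by rewrite (ord1 a)/=; apply: le_trans (yh i) (coordle h i).
have B0 : `|pd 0 f (x + s *: e_ 0) - pd 0 f x| <= e / 2.
  apply: H0; apply: le_lt_trans (norm_le _ _) (lt_le_trans hd _); last by rewrite ge_min lexx.
  by apply: ord2P; rewrite !mxE/= ?mulr1// mulr0 normr0.
have B1 : `|pd 1 f (x + h 0 0 *: e_ 0 + t *: e_ 1) - pd 1 f x| <= e / 2.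
  rewrite -addrA; apply: H1.
  apply: le_lt_trans (norm_le _ _) (lt_le_trans hd _); last by rewrite ge_min lexx orbT.
  by apply: ord2P; rewrite !mxE/= ?mulr1 ?mulr0 ?addr0 ?add0r.
rewrite LE.
have -> : f (h + x) - (f x + (h 0 0 * pd 0 f x + h 0 1 * pd 1 f x)) =
   (pd 1 f (x + h 0 0 *: e_ 0 + t *: e_ 1) - pd 1 f x) * h 0 1 +
   (pd 0 f (x + s *: e_ 0) - pd 0 f x) * h 0 0.
  have E1' : f (x + h 0 0 *: e_ 0) - f x = pd 0 f (x + s *: e_ 0) * h 0 0 by exact: E1.
  have E2' : f (h + x) - f (x + h 0 0 *: e_ 0) =
    pd 1 f (x + h 0 0 *: e_ 0 + t *: e_ 1) * h 0 1 by exact: E2.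
  move: E1' E2' {B0 B1 E1 E2}.
  move: (f (h + x)) (f x) (f _) (pd 0 f (_ + _)) (pd 1 f (_ + _)) (pd 0 f x) (pd 1 f x).
  by move=> P X Y p0 p1 q0 q1 E1 E2; rewrite !mulrBl -E1 -E2; ring.
apply: le_trans (ler_normD _ _) _; rewrite !normrM (splitr e) mulrDl.
by apply: lerD; apply: ler_pM => //; exact: coordle.
Qed.

Lemma Ck1_differentiable (F : 'rV[R]_2 -> 'rV[R]_2) (x : 'rV[R]_2) :
  smooth setT F -> differentiable F x.
Proof.
move=> sF; have [_ dF] := sF 1%N.
have D i j y : derivable (fun y => F y 0 j) y (delta_mx 0 i).
  by have [+ _] := dF (delta_mx 0 i); move=> /(_ y I)/derivable_mxP; apply.
have C i j : {for x, continuous (pd i (fun y => F y 0 j))}.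
  have [d [c _]] := dF (delta_mx 0 i).
  have -> : pd i (fun y => F y 0 j) = (fun y => ('D_(delta_mx 0 i) F y) 0 j).
    by apply/funext => y; rewrite derive_mx ?mxE//; exact: d.
  apply: (@continuous_comp _ _ _ _ (fun M : 'rV[R]_2 => M 0 j)); first exact: c.
  exact: coord_continuous.
have G j : differentiable (fun y => F y 0 j) x by apply: C1_differentiable.
have -> : F = \sum_j (fun y => F y 0 j *: delta_mx 0 j).
  apply/funext => y; rewrite [LHS]row_sum_delta.
  by rewrite fct_sumE.
by apply: differentiable_sum => j; exact: differentiableZl.
Qed.

Lemma derive_Jac (F : 'rV[R]_2 -> 'rV[R]_2) (x v : 'rV[R]_2) :
  differentiable F x -> 'd F x v = v *m Jac F x.
Proof.
move=> dF; rewrite {1}[v]row_sum_delta linear_sum/=.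
apply/rowP => j; rewrite summxE mxE; apply: eq_bigr => i _.
by rewrite linearZ !mxE /pd deriveE.
Qed.

End C1_differentiable.

(** * Loops in the class (0, 1) *)

Section lattice_translation.
Variable R : realType.
Implicit Types F : 'rV[R]_2 -> 'rV[R]_2.

Lemma int_valued_const (f : R -> R) :
  {within `[0, 1], continuous f} ->
  (forall s, 0 <= s <= 1 -> f s \is a Num.int) -> f 0 = f 1.
Proof.
move=> cf fint.
have key (g : R -> R) : {within `[0, 1], continuous g} ->
    (forall s, 0 <= s <= 1 -> g s \is a Num.int) -> ~ (g 0 < g 1).
  move=> cg gint g01.
  have /intrP[m mE] : g 0 \is a Num.int by apply: gint; rewrite lexx ler01.
  have /intrP[n nE] : g 1 \is a Num.int by apply: gint; rewrite lexx ler01.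
  have mn : m%:~R + 1 <= n%:~R :> R.
    by rewrite -intrD1 ler_int lezD1 -(ltr_int R) -mE -nE.
  have [|c] := @IVT R g 0 1 (g 0 + 2^-1) ler01 cg.
    by rewrite (min_idPl (ltW g01)) (max_idPr (ltW g01)) nE mE; apply/andP; split; lra.
  rewrite in_itv/= => c01 cE; have /intrP[k kE] := gint c c01.
  have h1 : (m < k)%R by rewrite -(ltr_int R) -kE cE mE; lra.
  have h2 : (k < m + 1)%R by rewrite -(ltr_int R) intrD1 -kE cE mE; lra.
  by move: h2; rewrite ltzD1 leNgt h1.
apply/eqP; rewrite eq_le !leNgt; apply/andP; split; apply/negP.
  move=> h; apply: (key (fun s => - f s)); last by rewrite ltrN2.
    by move=> x; apply: continuousN; exact: cf.
  by move=> s s01; rewrite rpredN fint.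
exact: key.
Qed.

Lemma lattice_const (f : R -> 'rV[R]_2) :
  {within `[0, 1], continuous f} -> (forall s, 0 <= s <= 1 -> lattice (f s)) ->
  f 0 = f 1.
Proof.
move=> cf lf; apply/rowP => i.
apply: (@int_valued_const (fun s => f s 0 i)); last by move=> s /lf.
apply/subspace_continuousP => x x01.
have /subspace_continuousP/(_ x x01) cfx := cf.
by apply: (cvg_comp f (fun M : 'rV[R]_2 => M 0 i) cfx); exact: coord_continuous.
Qed.

Lemma lattice_delta (i : 'I_2) : lattice (delta_mx 0 i : 'rV[R]_2).
Proof. by move=> j; rewrite mxE; case: (_ && _); rewrite ?int_num1 ?int_num0. Qed.

(** For a homotopy H, the vector H(s, p + k) - H(s, p) is in the lattice and
   continuous in s, hence independent of s.  At both ends H differs from the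
   identity and from F by lattice vectors, which for the same reason take equal
   values at p and p + k. *)
Lemma homotopic_id_translation F : continuous F -> homotopic_to_id F ->
  forall (k p : 'rV[R]_2), lattice k -> F (p + k) = F p + k.
Proof.
move=> cF [H [cH tH H0 H1]] k p lk.
have slice (q : 'rV[R]_2) : {within `[0, 1], continuous (fun s => H (s, q))}.
  apply/subspace_continuousP => s s01 A HA.
  have /subspace_continuousP/(_ (s, q)) cHs := cH.
  have {}s01 : 0 <= s <= 1 by move: s01; rewrite /= in_itv.
  have W : \forall z \near (s, q), 0 <= z.1 <= 1 -> A (H z) := cHs s01 A HA.
  have := near_pair_l W; apply: filterS => y h y01; apply: h.
  by move: y01; rewrite /= in_itv.
have path_cont (s : R) (sE : 0 <= s <= 1) : continuous (fun q : 'rV[R]_2 => H (s, q)).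
  move=> q A HA.
  have /subspace_continuousP/(_ (s, q)) cHs := cH.
  have W : \forall z \near (s, q), 0 <= z.1 <= 1 -> A (H z) := cHs sE A HA.
  by have := near_pair_r W; apply: filterS => y; apply.
have segc : continuous (fun r : R => p + r *: k).
  move=> r; apply: cvgD; first exact: cvg_cst.
  exact: scalel_continuous.
have o01 : (0 : R) <= (0 : R) <= 1 by rewrite lexx ler01.
have i01 : (0 : R) <= (1 : R) <= 1 by rewrite lexx ler01.
have E : H (0, p + k) - H (0, p) = H (1, p + k) - H (1, p).
  apply: (@lattice_const (fun s => H (s, p + k) - H (s, p))).
    by move=> x; apply: cvgB; exact: slice.
  by move=> s s01; apply: tH.
have E0 : H (0, p) - p = H (0, p + k) - (p + k).
  have := @lattice_const (fun r => H (0, p + r *: k) - (p + r *: k)).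
  rewrite scale0r addr0 scale1r; apply; last by move=> r _; exact: H0.
  apply: continuous_subspaceT => r; apply: cvgB; last exact: segc.
  by apply: (cvg_comp _ (fun q => H (0, q)) (segc r)); exact: path_cont.
have E1 : H (1, p) - F p = H (1, p + k) - F (p + k).
  have := @lattice_const (fun r => H (1, p + r *: k) - F (p + r *: k)).
  rewrite scale0r addr0 scale1r; apply; last by move=> r _; exact: H1.
  apply: continuous_subspaceT => r; apply: cvgB.
    by apply: (cvg_comp _ (fun q => H (1, q)) (segc r)); exact: path_cont.
  by apply: (cvg_comp _ F (segc r)); exact: cF.
move: E E0 E1; move: (H (0, p)) (H (0, p + k)) (H (1, p)) (H (1, p + k)) (F (p + k)) (F p).
move=> A B C D X Y E E0 E1; apply/rowP => i.
move/rowP/(_ i): E; move/rowP/(_ i): E0; move/rowP/(_ i): E1; rewrite !mxE; lra.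
Qed.

End lattice_translation.

Section loops.
Variable R : realType.

Definition dir2 : 'rV[R]_2 := delta_mx 0 1.

(** A path from p to p + (0, 1) of squared speed less than L covers a loop of
   T^2 in the class (0, 1).  The uniform bounds c < L and B make the condition
   stable under small changes of the metric. *)
Definition short_loop (g : 'rV[R]_2 -> 'M[R]_2) (L : R) : Prop :=
  exists gam : R -> 'rV[R]_2, exists c B : R,
  [/\ (forall s, derivable gam s 1), gam 1 = gam 0 + dir2, c < L &
   forall s, 0 <= s <= 1 -> (forall i, `|'D_1 gam s 0 i| <= B) /\
     ('D_1 gam s *m g (gam s) *m ('D_1 gam s)^T) 0 0 <= c].

Lemma bounded_path (f : R -> R) : continuous f ->
  exists C, forall s, 0 <= s <= 1 -> f s <= C.
Proof.
move=> cf; have [c _ H] := @EVT_max R f 0 1 ler01 (continuous_subspaceT cf).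
by exists (f c) => s s01; apply: H; rewrite in_itv.
Qed.

Lemma short_loop_exists (g : flat_metric R) :
  exists L0, forall L, L0 < L -> short_loop g L.
Proof.
have cg : continuous (fun s : R => (g (s *: dir2)) 1 1).
  have cG : continuous (g : 'rV[R]_2 -> 'M[R]_2).
    by have [c _] := fmx_smooth g 0%N; move=> p; exact: c.
  move=> s; have c1 : s' *: dir2 @[s' --> s] --> s *: dir2 by exact: scalel_continuous.
  have c2 := cvg_comp _ (g : 'rV[R]_2 -> 'M[R]_2) c1 (cG _).
  by apply: (cvg_comp _ (fun M : 'M[R]_2 => M 1 1) c2); exact: coord_continuous.
have [C HC] := bounded_path cg; exists C => L CL.
have line : (fun s : R => s *: dir2) = (fun s : R => 0 + s *: dir2).
  by apply/funext => s; rewrite add0r.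
have D (s : R) : is_derive s 1 (fun s : R => s *: dir2) dir2.
  have dI : derivable (fun x : 'rV[R]_2 => x) (0 + s *: dir2) dir2 by exact: derivable_id.
  by rewrite line; apply: is_derive_eq (is_derive_line dI) _; exact: derive_id.
exists (fun s => s *: dir2), C, 1; split => //.
- by rewrite scale1r scale0r add0r.
- move=> s s01; rewrite derive_val; split.
    by apply: ord2P; rewrite !mxE/= ?normr0 ?normr1 ?ler01.
  rewrite [leLHS](_ : _ = g (s *: dir2) 1 1); first exact: HC.
  by rewrite !mxE sum2 !mxE !sum2 !mxE/=; ring.
Qed.

(** The g_a-product with (0, 1) increases by a^2 + 1 along the path, so at some
   time its derivative is a^2 + 1, and the Cauchy-Schwarz inequality applies. *)
Lemma short_loop_flat (a L : R) : short_loop (flat_of a) L -> a ^+ 2 + 1 < L.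
Proof.
move=> [gam [c [B [D E cL H]]]].
pose l (v : 'rV[R]_2) : R := a * (v 0 0 + a * v 0 1) + v 0 1.
have Dl (s : R) : is_derive s 1 (fun s => l (gam s)) (l ('D_1 gam s)).
  have Di i : is_derive s 1 (fun s => gam s 0 i) ('D_1 gam s 0 i).
    have d : derivable (fun s => gam s 0 i) s 1 by have /derivable_mxP := D s; apply.
    by apply: DeriveDef => //; rewrite derive_mx ?mxE//; exact: D.
  have D0 := Di 0; have D1 := Di 1.
  by apply: is_derive_eq; rewrite /l /GRing.scale/=; ring.
have cl : continuous (fun s => l (gam s)).
  by move=> s; apply: differentiable_continuous; apply/derivable1_diffP; case: (Dl s).
have [s] := @MVT_segment _ _ _ 0 1 ler01 (fun x _ => Dl x) (continuous_subspaceT cl).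
rewrite in_itv/= => s01; rewrite E /l !mxE/=.
have [_] := H s s01; rewrite torus_form_quad.
set v0 := 'D_1 gam s 0 0; set v1 := 'D_1 gam s 0 1.
move=> Q M; apply: le_lt_trans cL.
have {}M : a ^+ 2 + 1 = a * (v0 + a * v1) + v1 by move: M; lra.
have CS : (a * (v0 + a * v1) + v1) ^+ 2 <= (a ^+ 2 + 1) * ((v0 + a * v1) ^+ 2 + v1 ^+ 2).
  by have := sqr_ge0 (a * v1 - (v0 + a * v1)); lra.
rewrite -M expr2 in CS.
have q0 : 0 < a ^+ 2 + 1 by have := sqr_ge0 a; lra.
by move: CS; rewrite ler_pM2l// => /le_trans; apply.
Qed.

Lemma short_loop_le g (L L' : R) : L <= L' -> short_loop g L -> short_loop g L'.
Proof.
move=> LL [gam [c [B [D E cL H]]]]; exists gam, c, B; split => //.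
exact: lt_le_trans LL.
Qed.

(** Changing the entries of the metric by at most d changes the squared speed by
   at most 4 B^2 d. *)
Lemma short_loop_open (L : R) : open [set g : flat_metric R | short_loop g L].
Proof.
have : Cinf_open [set g : flat_metric R | short_loop g L]; last by [].
move=> g [gam [c [B [D E cL H]]]].
pose b := 4 * B ^+ 2 + 1; have b0 : 0 < b by have := sqr_ge0 B; rewrite /b; lra.
pose d := (L - c) / (2 * b); have d0 : 0 < d by rewrite divr_gt0 ?subr_gt0 ?mulr_gt0.
exists 0%N, d => // h gh.
exists gam, ((c + L) / 2), B; split => //; first lra.
move=> s s01; have [HB Hc] := H s s01; split=> //.
have gd i j : `|h (gam s) i j - g (gam s) i j| <= d.
  apply: le_trans (gh [::] (gam s) isT).
  rewrite [leRHS]/Num.Def.normr/= mx_normrE.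
  have := @le_bigmax _ _ _ 0 (fun ij => `|(h (gam s) - g (gam s)) ij.1 ij.2|) (i, j).
  by rewrite /= !mxE.
have B0 : 0 <= B by apply: le_trans (HB 0).
set v := 'D_1 gam s in HB Hc *.
have -> : (v *m h (gam s) *m v^T) 0 0 = (v *m g (gam s) *m v^T) 0 0 +
  \sum_i \sum_j v 0 i * v 0 j * (h (gam s) i j - g (gam s) i j).
  by rewrite !mxE !sum2 !mxE !sum2; ring.
have T i j : v 0 i * v 0 j * (h (gam s) i j - g (gam s) i j) <= B ^+ 2 * d.
  apply: le_trans (ler_norm _) _; rewrite !normrM.
  by apply: ler_pM => //; rewrite expr2; exact: ler_pM.
rewrite !sum2; have := T 0 0; have := T 0 1; have := T 1 0; have := T 1 1.
have : 4 * B ^+ 2 * d <= (L - c) / 2.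
  have -> : (L - c) / 2 = b * d.
    by rewrite /d invfM mulrCA mulrA [_ * b^-1]mulrC -mulrA; field; rewrite gt_eqF.
  by apply: ler_wpM2r; [exact: ltW|rewrite /b lerDl].
lra.
Qed.

End loops.

(** * Exit from compact subsets of Teichmueller space *)

Section exit.
Variable R : realType.
Implicit Types F : 'rV[R]_2 -> 'rV[R]_2.

Lemma derive_path_comp F (gam : R -> 'rV[R]_2) (s : R) :
  smooth setT F -> derivable gam s 1 ->
  derivable (F \o gam) s 1 /\ 'D_1 (F \o gam) s = 'D_1 gam s *m Jac F (gam s).
Proof.
move=> sF dg; have dF := Ck1_differentiable (gam s) sF.
have {}dg : differentiable gam s by apply/derivable1_diffP.
have dc := differentiable_comp dg dF.
split; first exact: diff_derivable.
have E1 : 'D_1 (F \o gam) s = 'd (F \o gam) s 1  by exact: deriveE dc.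
have E2 : 'd (F \o gam) s 1 = 'd F (gam s) ('d gam s 1).
  exact: (congr1 (fun f => f 1) (diff_comp dg dF)).
have E3 : 'D_1 gam s = 'd gam s 1  by exact: deriveE dg.
by rewrite E1 E2 -E3 derive_Jac.
Qed.

Lemma Jac_cancel F F' q : smooth setT F -> smooth setT F' -> cancel F' F ->
  Jac F' q *m Jac F (F' q) = 1%:M.
Proof.
move=> sF sF' FK.
have dF := Ck1_differentiable (F' q) sF; have dF' := Ck1_differentiable q sF'.
have E (v : 'rV[R]_2) : v *m (Jac F' q *m Jac F (F' q)) = v.
  rewrite mulmxA -(derive_Jac _ dF') -(derive_Jac _ dF).
  have := congr1 (fun f => f v) (diff_comp dF' dF) => /= <-.
  rewrite (_ : F \o F' = id); last by apply/funext => x /=; exact: FK.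
  by rewrite diff_val.
by apply/row_matrixP => i; rewrite !rowE E mulmx1.
Qed.

Lemma pullback_cancel F F' (g h : 'rV[R]_2 -> 'M[R]_2) :
  smooth setT F -> smooth setT F' -> cancel F' F ->
  (forall p, h p = pullback F g p) -> forall p, g p = pullback F' h p.
Proof.
move=> sF sF' FK hE p; rewrite /pullback hE /pullback FK.
rewrite -!mulmxA -trmx_mul !mulmxA (Jac_cancel _ sF sF' FK) trmx1.
by rewrite mul1mx mulmx1.
Qed.

(** F is an isometry from h to g that commutes with the translation, so it maps
   the path to a path of the same speed. *)
Lemma short_loop_push F (g h : 'rV[R]_2 -> 'M[R]_2) L :
  smooth setT F -> (forall p, F (p + dir2 R) = F p + dir2 R) ->
  (forall p, h p = pullback F g p) -> short_loop h L -> short_loop g L.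
Proof.
move=> sF Fe hE [gam [c [B [D E cL H]]]].
have cg : continuous gam.
  by move=> s; apply: differentiable_continuous; apply/derivable1_diffP.
have cN (j : 'I_2) : continuous (fun s => `|pd j F (gam s)|).
  move=> s; have [_ /(_ (delta_mx 0 j))[_ [cF _]]] := sF 1%N.
  have c2 := cvg_comp _ (pd j F) (cg s) (cF (gam s) I).
  by apply: (cvg_comp _ (fun x : 'rV[R]_2 => `|x|) c2); exact: norm_continuous.
have [C0 H0] := bounded_path (cN 0); have [C1 H1] := bounded_path (cN 1).
exists (F \o gam), c, (B * C0 + B * C1); split; [| |exact: cL|].
- by move=> s; have [] := derive_path_comp sF (D s).
- by rewrite /= E Fe.
move=> s s01; have [HB Hc] := H s s01.
have [_ ->] := derive_path_comp sF (D s); split; last first.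
  by move: Hc; rewrite hE /pullback trmx_mul !mulmxA.
have coordle (y : 'rV[R]_2) i : `|y 0 i| <= `|y|.
  rewrite [leRHS]/Num.Def.normr/= mx_normrE.
  exact: (@le_bigmax _ _ _ 0 (fun ij => `|y ij.1 ij.2|) (0, i)).
move=> i; rewrite mxE sum2; apply: le_trans (ler_normD _ _) _; rewrite !normrM !mxE.
by apply: lerD; apply: ler_pM => //;
  apply: le_trans (coordle _ _) _; [exact: H0|exact: H1].
Qed.

Lemma short_loop_teich (g h : flat_metric R) L :
  teich_rel g h -> (short_loop g L <-> short_loop h L).
Proof.
move=> [F [[F' [[tF tF'] sF sF' FK F'K]] hF hE]].
have cF : continuous F by have [c _] := sF 0%N; move=> p; exact: c.
have Fe p : F (p + dir2 R) = F p + dir2 R.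
  exact: homotopic_id_translation cF hF _ _ (lattice_delta _ _).
have F'e p : F' (p + dir2 R) = F' p + dir2 R by rewrite -{1}[p]F'K -Fe FK.
split; last exact: short_loop_push sF Fe hE.
exact: short_loop_push sF' F'e (pullback_cancel sF sF' F'K hE).
Qed.

Lemma short_loop_class (g h : flat_metric R) L :
  teich_class g = teich_class h -> short_loop g L -> short_loop h L.
Proof.
move=> /eqmodP/asboolP H.
suff : short_loop g L <-> short_loop h L by move=> [].
elim: H => {g h} [g h|g|g h _ IH|g h k _ IH1 _ IH2].
- exact: short_loop_teich.
- by [].
- exact: iff_sym.
- exact: iff_trans IH2.
Qed.

Lemma teich_class_surj (c : teichmuller R) : exists g, teich_class g = c.
Proof.
by exists (repr (c : {eq_quot (generated_equiv_rel (@teich_rel R))})); exact: reprK.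
Qed.

Definition loop_sublevel (L : R) : set (teichmuller R) :=
  [set c | exists2 g, teich_class g = c & short_loop g L].

Lemma loop_sublevel_open L : open (loop_sublevel L).
Proof.
have -> : open (loop_sublevel L) = open (@teich_class R @^-1` loop_sublevel L) by [].
rewrite (_ : _ @^-1` _ = [set g : flat_metric R | short_loop g L]).
  exact: short_loop_open.
apply/seteqP; split=> [g [h /= E hL]|g gL]; last by exists g.
exact: short_loop_class E hL.
Qed.

(** The sets loop_sublevel L are open and increase to the whole space. *)
Lemma compact_loop_sublevel (K : set (teichmuller R)) : compact K ->
  exists L, K `<=` loop_sublevel L.
Proof.
move=> /compact_near_coveringP/(_ nat \oo (fun n c => loop_sublevel n%:R c) _) H.
suff /H[N _ KN] : forall c, K c ->
    \forall c' \near c & n \near \oo, loop_sublevel n%:R c'.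
  by exists N%:R; exact: (KN N (leqnn N)).
move=> c _; have [g0 g0c] := teich_class_surj c.
have [L0 HL] := short_loop_exists g0.
have [M L1] : exists M : nat, L0 < M%:R.
  have [L00|L00] := leP 0 L0; first by exists (Num.bound L0); exact: archi_boundP.
  by exists 0%N.
exists (loop_sublevel M%:R, [set n | (M <= n)%N]).
  split; last by exists M.
  apply: open_nbhs_nbhs; split; first exact: loop_sublevel_open.
  by exists g0; last exact: HL.
move=> [c' n] [/= [g gc gM] Mn]; exists g => //.
by apply: short_loop_le gM; rewrite ler_nat.
Qed.

End exit.

Theorem corollary1p3 (R : realType) (eta : R) (eta_gt0 : 0 < eta) :
  exists (d : nat) (N : closed_manifold R d) (gN : riem_metric N)
         (u : R -> 'rV[R]_2 -> N) (g : R -> flat_metric R),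
    [/\ thm_flow eta gN u g,
        forall K : set (teichmuller R), compact K ->
          exists T : R, forall t, 0 <= t -> T <= t -> ~ K (teich_class (g t)),
        (0 < ereal_inf [set inj_radius (g t) | t in [set t : R | (0 <= t)%R]])%E &
        exists2 K : set (moduli R), compact K &
          forall t, 0 <= t -> K (moduli_class (g t))].
Proof.
exists 4%N, (target R), (target_metric (kap_gt0 eta_gt0)), (flow_u eta), (flow_g eta); split.
- exact: flow_solution.
- move=> K /compact_loop_sublevel[L KL].
  (* From this time on a = z >= |L| + 1, and a^2 >= a as a > 2. *)
  exists (expR (`|L| + 1) / speed eta) => t t0; rewrite ler_pdivrMr ?speed_gt0// => tL.
  move=> /KL[g gE gL].
  have := short_loop_flat (short_loop_class gE gL).
  have h := zt_gt2 (time_dom_ge0 eta_gt0 t0).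
  have Tl : `|L| + 1 <= zt eta t.
    rewrite /zt -[leLHS]expRK ler_ln ?posrE ?expR_gt0//.
      by rewrite mulrC; apply: le_trans tL _; rewrite lerDl expR_ge0.
    by rewrite ltr_wpDr ?expR_ge0// mulrC; exact: lt_le_trans (expR_gt0 _) tL.
  by have := ler_norm L; nra.
- apply: lt_le_trans (_ : (2^-1)%:E <= _)%E; first by rewrite lte_fin invr_gt0.
  by apply: le_ereal_inf_tmp => _ [t _ <-]; exact: flat_inj_radius.
- have [K cK HK] := flat_moduli_compact R.
  by exists K => // t _; exact: HK.
Qed.
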